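(* Let $\mathcal A$ be a flat regular multiplier Hopf algebroid with base weight $\mu$. For every full and faithful left integral $\phi$ and every full and faithful right integral $\psi$ on $\mathcal A$ adapted to $\mu$, $$M(B)\cdot\phi=\{\text{left integrals on }\mathcal A\text{ adapted to }\mu\}=\phi\cdot M(B),$$ $$M(C)\cdot\psi=\{\text{right integrals on }\mathcal A\text{ adapted to }\mu\}=\psi\cdot M(C).$$
   Context: Conventions. Algebras are over $\mathbb C$ and need not be unital; products $XY$ of subspaces denote linear spans. An algebra $A$ is non-degenerate if $aA\neq 0\neq Aa$ for $a\ne 0$; $M(A)$ is its multiplier algebra. $A^\vee$ is the dual vector space; $(T\cdot\omega)(b)=\omega(bT)$, $(\omega\cdot T)(b)=\omega(Tb)$ for $T\in M(A)$. A functional $\omega$ on $D$ is faithful if $\omega(dD)\ne0\ne\omega(Dd)$ for all $d\neq 0$. Regular multiplier Hopf algebroids. Compatible left and right quantum graphs consist of a non-degenerate algebra $A$, commuting subalgebras $B,C\subseteq M(A)$ and anti-isomorphisms $S_B:B\to C$, $S_C:C\to B$ with $BA=AB=CA=AC=A$, such that (i) either every finite $F\subseteq A$ admits $e\in A$ with $ae=a$ for $a\in F$, or the left modules ${}_BA,{}_CA$ are flat; (ii) either every finite $F\subseteq A$ admits $e\in A$ with $ea=a$ for $a\in F$, or the right modules $A_B,A_C$ are flat. Since $BA=A=AB$ and $CA=A=AC$, $M(B)$ and $M(C)$ act on $A$ from both sides and are regarded as subalgebras of $M(A)$. Quotients of $A\otimes A$ are defined by the relations (for $x\in B$, $y\in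 C$): $A\otimes_BA$: $ax\otimes b=a\otimes xb$; $A\otimes_CA$: $ay\otimes b=a\otimes yb$; $A\otimes^BA$: $xa\otimes b=a\otimes bx$; $A\otimes^CA$: $ya\otimes b=a\otimes by$; $A\otimes_lA$: $xa\otimes b=a\otimes S_B(x)b$; $A\otimes_rA$: $aS_C(y)\otimes b=a\otimes by$. A left comultiplication is a homomorphism $\Delta_B:A\to\mathrm{End}(A\otimes_lA)$ such that for each $a$ there are elements $\Delta_B(a)(1\otimes b)$, $\Delta_B(a)(b\otimes1)$ of $A\otimes_lA$ with $\Delta_B(a)(b\otimes c)=(\Delta_B(a)(1\otimes c))(b\otimes1)=(\Delta_B(a)(b\otimes1))(1\otimes c)$, and $\Delta_B(xyax'y')=(y\otimes x)\Delta_B(a)(y'\otimes x')$ for $x,x'\in B$, $y,y'\in C$, and $((\Delta_B\otimes\mathrm{id})(\Delta_B(b)(1\otimes c)))(a\otimes1\otimes1)=((\mathrm{id}\otimes\Delta_B)(\Delta_B(b)(a\otimes1)))(1\otimes1\otimes c)$. A right comultiplication is a homomorphism $\Delta_C:A\to\mathrm{End}(A\otimes_rA)^{op}$ (acting from the right) such that there are elements $(a\otimes1)\Delta_C(c),(1\otimes b)\Delta_C(c)\in A\otimes_rA$ with $(a\otimes b)\Delta_C(c)=(1\otimes b)((a\otimes1)\Delta_C(c))=(a\otimes1)((1\otimes b)\Delta_C(c))$, and $\Delta_C(xyax'y')=(y\otimes x)\Delta_C(a)(y'\otimes x')$, $(a\otimes1\otimes1)((\Delta_C\otimes\mathrm{id})((1\otimes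 c)\Delta_C(b)))=(1\otimes1\otimes c)((\mathrm{id}\otimes\Delta_C)((a\otimes1)\Delta_C(b)))$. These data form a multiplier bialgebroid $\mathcal A$ if also $((\Delta_B\otimes\mathrm{id})((1\otimes c)\Delta_C(b)))(a\otimes1\otimes1)=(1\otimes1\otimes c)((\mathrm{id}\otimes\Delta_C)(\Delta_B(b)(a\otimes1)))$ and $(a\otimes1\otimes1)((\Delta_C\otimes\mathrm{id})(\Delta_B(b)(1\otimes c)))=((\mathrm{id}\otimes\Delta_B)((a\otimes1)\Delta_C(b)))(1\otimes1\otimes c)$. It is a regular multiplier Hopf algebroid if the canonical maps $T_\lambda:A\otimes^CA\to A\otimes_lA$, $a\otimes b\mapsto\Delta_B(b)(a\otimes1)$; $T_\rho:A\otimes_BA\to A\otimes_lA$, $a\otimes b\mapsto\Delta_B(a)(1\otimes b)$; ${}_\lambda T:A\otimes_CA\to A\otimes_rA$, $a\otimes b\mapsto(a\otimes1)\Delta_C(b)$; ${}_\rho T:A\otimes^BA\to A\otimes_rA$, $a\otimes b\mapsto(1\otimes b)\Delta_C(a)$ are bijective. It is flat if the modules ${}_BA,A_B,{}_CA,A_C$ are all flat. Sweedler notation: $\Delta_B(a)(1\otimes b)=\sum a_{(1)}\otimes a_{(2)}b$, $\Delta_B(b)(a\otimes 1)=\sum b_{(1)}a\otimes b_{(2)}$, $(a\otimes1)\Delta_C(b)=\sum ab_{(1)}\otimes b_{(2)}$, $(1\otimes b)\Delta_C(a)=\sum a_{(1)}\otimes ba_{(2)}$. There are then a unique left counit ${}_B\varepsilon:A\to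 B$ and right counit $\varepsilon_C:A\to C$ with ${}_B\varepsilon(xa)=x\,{}_B\varepsilon(a)$, ${}_B\varepsilon(S_B(x)a)={}_B\varepsilon(a)x$, $\sum S_B({}_B\varepsilon(a_{(1)}))a_{(2)}b=ab$, $\sum{}_B\varepsilon(b_{(2)})b_{(1)}a=ba$, ${}_B\varepsilon(ab)={}_B\varepsilon(a\,{}_B\varepsilon(b))={}_B\varepsilon(aS_B({}_B\varepsilon(b)))$, and $\varepsilon_C(ay)=\varepsilon_C(a)y$, $\varepsilon_C(aS_C(y))=y\varepsilon_C(a)$, $\sum ba_{(2)}\varepsilon_C(a_{(1)})=ba$, $\sum ab_{(1)}S_C(\varepsilon_C(b_{(2)}))=ab$, $\varepsilon_C(ab)=\varepsilon_C(\varepsilon_C(a)b)=\varepsilon_C(S_C(\varepsilon_C(a))b)$. Base weights and integrals. A base weight is a pair $\mu=(\mu_B,\mu_C)$ of faithful functionals on $B$ and $C$ with $\mu_B\circ S_C=\mu_C$, $\mu_C\circ S_B=\mu_B$, $\mu_B\circ{}_B\varepsilon=\mu_C\circ\varepsilon_C$. A functional $\omega\in A^\vee$ is adapted to $\mu$ if there are (necessarily unique) maps ${}_B\omega,\omega_B:A\to B$, ${}_C\omega,\omega_C:A\to C$ with $\omega(xa)=\mu_B(x\,{}_B\omega(a))$, $\omega(ax)=\mu_B(\omega_B(a)x)$, $\omega(ya)=\mu_C(y\,{}_C\omega(a))$, $\omega(ay)=\mu_C(\omega_C(a)y)$ for all $x\in B,y\in C,a\in A$. A left integral is an adapted $\phi$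 with $\sum S_B^{-1}({}_C\phi(b_{(2)}))b_{(1)}a={}_C\phi(b)a$ for all $a,b$, equivalently $\sum ab_{(1)}S_C(\phi_C(b_{(2)}))=a\phi_C(b)$ for all $a,b$ (then ${}_C\phi=\phi_C$). A right integral is an adapted $\psi$ with $\sum S_B({}_B\psi(a_{(1)}))a_{(2)}b={}_B\psi(a)b$ for all $a,b$, equivalently $\sum ba_{(2)}S_C^{-1}(\psi_B(a_{(1)}))=b\psi_B(a)$ for all $a,b$ (then ${}_B\psi=\psi_B$). A left integral $\phi$ is full if ${}_B\phi,\phi_B:A\to B$ are surjective; a right integral $\psi$ is full if ${}_C\psi,\psi_C:A\to C$ are surjective. *)

(* Defs.v *)
From HB Require Import structures.
From mathcomp Require Import all_boot all_order all_algebra.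
From mathcomp Require Import finmap monalg.
From mathcomp Require Import boolp classical_sets functions.

Set Implicit Arguments.
Unset Strict Implicit.
Unset Printing Implicit Defensive.

Import GRing.Theory.
Local Open Scope ring_scope.
Local Open Scope quotient_scope.

HB.mixin Record Lmodule_isNonUnitalAlgebra (K : fieldType) A
    of GRing.Lmodule K A := {
  numul : A -> A -> A;
  numulA : associative numul;
  numul_linearl : forall b, linear (numul^~ b);
  numul_linearr : forall a, linear (numul a) }.

#[short(type="nualgType")]
HB.structure Definition NonUnitalAlgebra (K : fieldType) :=
  {A of GRing.Lmodule K A & Lmodule_isNonUnitalAlgebra K A}.

Declare Scope nualg_scope.
Delimit Scope nualg_scope with nualg.
Local Open Scope nualg_scope.

Notation "a ** b" := (numul a b) (at level 40, left associativity) : nualg_scope.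

Definition nondegenerate (K : fieldType) (A : nualgType K) : Prop :=
  forall a : A, a != 0 ->
    (exists b : A, a ** b != 0) /\ (exists b : A, b ** a != 0).

Definition faithful_functional (K : fieldType) (D : nualgType K)
    (w : {scalar D}) : Prop :=
  forall d : D, d != 0 ->
    (exists d' : D, w (d ** d') != 0) /\ (exists d' : D, w (d' ** d) != 0).

Section NonUnitalTheory.
Variables (K : fieldType) (A : nualgType K).

HB.instance Definition _ (a : A) :=
  GRing.isLinear.Build K A A *:%R (numul a) (numul_linearr a).

Lemma numul0r (a : A) : a ** 0 = 0. Proof. exact: raddf0. Qed.
Lemma numulDr (a b c : A) : a ** (b + c) = a ** b + a ** c.
Proof. exact: raddfD. Qed.
Lemma numulZr (k : K) (a b : A) : a ** (k *: b) = k *: (a ** b).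
Proof. exact: linearZ. Qed.

Lemma numulDl (a b c : A) : (a + b) ** c = a ** c + b ** c.
Proof. by have := numul_linearl c 1 a b; rewrite !scale1r. Qed.
Lemma numul0l (a : A) : 0 ** a = 0.
Proof. by apply: (addIr (0 ** a)); rewrite -numulDl !add0r. Qed.
Lemma numulZl (k : K) (a b : A) : (k *: a) ** b = k *: (a ** b).
Proof. by have := numul_linearl b k a 0; rewrite numul0l !addr0. Qed.

End NonUnitalTheory.

(* A multiplier T is encoded by the pair of maps a |-> T a and a |-> a T. *)
Definition is_multiplier (K : fieldType) (A : nualgType K)
    (T : (A -> A) * (A -> A)) : Prop :=
  (linear T.1 /\ linear T.2) /\
  [/\ forall a b, T.1 (a ** b) = T.1 a ** b,
      forall a b, T.2 (a ** b) = a ** T.2 b &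
      forall a b, a ** T.1 b = T.2 a ** b].

Section MultiplierAlgebra.
Variables (K : fieldType) (A : nualgType K).
Implicit Types (a b : A).

Definition multiplier_pred : {pred (A -> A) * (A -> A)} :=
  fun T => `[< is_multiplier T >].

Lemma multiplier_subproof : subsemimod_closed multiplier_pred.
Proof.
split; [split|].
- apply/asboolP; split; first by split=> k x y; rewrite /= scaler0 addr0.
  by split=> a b /=; rewrite ?numul0l ?numul0r.
- move=> S T /asboolP[[S1 S2] [Sl Sr Sm]] /asboolP[[T1 T2] [Tl Tr Tm]].
  apply/asboolP; split; first by split=> k x y;
    rewrite /= !fctE ?S1 ?T1 ?S2 ?T2 scalerDr addrACA.
  by split=> a b; rewrite /= !fctE ?Sl ?Tl ?Sr ?Tr ?numulDl ?numulDr ?Sm ?Tm.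
- move=> c T /asboolP[[T1 T2] [Tl Tr Tm]]; apply/asboolP; split.
    by split=> k x y; rewrite /= !fctE ?T1 ?T2 scalerDr !scalerA mulrC.
  by split=> a b; rewrite /= !fctE ?Tl ?Tr ?numulZl ?numulZr ?Tm.
Qed.

Record multiplier : predArgType := Multiplier {
  mulval : (A -> A) * (A -> A);
  mulvalP : mulval \in multiplier_pred }.

HB.instance Definition _ := [isSub for mulval].
HB.instance Definition _ := [Choice of multiplier by <:].
HB.instance Definition _ :=
  GRing.SubChoice_isSubLmodule.Build K _ _ multiplier multiplier_subproof.

Definition lact (T : multiplier) (a : A) : A := (mulval T).1 a.
Definition ract (a : A) (T : multiplier) : A := (mulval T).2 a.

Definition mulm_val (S T : multiplier) : (A -> A) * (A -> A) :=
  ((mulval S).1 \o (mulval T).1, (mulval T).2 \o (mulval S).2).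

Lemma mulm_subproof S T : mulm_val S T \in multiplier_pred.
Proof.
have /asboolP[[S1 S2] [Sl Sr Sm]] := mulvalP S.
have /asboolP[[T1 T2] [Tl Tr Tm]] := mulvalP T.
apply/asboolP; split; first by split=> k x y; rewrite /= ?T1 ?S1 ?S2 ?T2.
by split=> a b; rewrite /= ?Tl ?Sl ?Sr ?Tr ?Sm ?Tm.
Qed.

Definition mulm (S T : multiplier) : multiplier :=
  Multiplier (mulm_subproof S T).

Lemma mulmA : associative mulm.
Proof. by move=> R S T; apply: val_inj. Qed.

Lemma mulm_linearl T : linear (mulm^~ T).
Proof.
move=> k R S; apply: val_inj; have /asboolP[[T1 T2] _] := mulvalP T.
by congr pair; apply: funext => a; rewrite /= !fctE ?T2.
Qed.

Lemma mulm_linearr S : linear (mulm S).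
Proof.
move=> k R T; apply: val_inj; have /asboolP[[S1 S2] _] := mulvalP S.
by congr pair; apply: funext => a; rewrite /= !fctE ?S1.
Qed.

HB.instance Definition _ :=
  Lmodule_isNonUnitalAlgebra.Build K multiplier mulmA mulm_linearl mulm_linearr.

End MultiplierAlgebra.

Notation "T ▷ a" := (lact T a) (at level 40, left associativity) : nualg_scope.
Notation "a ◁ T" := (ract a T) (at level 40, left associativity) : nualg_scope.

(* Subalgebras of M(A); for S : subalgM A, the type of elements of S is itself
   a non-unital algebra, and its elements coerce to multipliers of A. *)
Record subalgM (K : fieldType) (A : nualgType K) := SubalgM {
  subalgM_pred : {pred multiplier A};
  subalgM_submod : subsemimod_closed subalgM_pred;
  subalgM_mul : forall S T, S \in subalgM_pred -> T \in subalgM_pred ->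
    S ** T \in subalgM_pred }.

Section SubalgebraType.
Variables (K : fieldType) (A : nualgType K) (S : subalgM A).

Record subalgM_type : predArgType := SubalgMType {
  subalgM_val : multiplier A;
  subalgM_valP : subalgM_val \in subalgM_pred S }.

HB.instance Definition _ := [isSub for subalgM_val].
HB.instance Definition _ := [Choice of subalgM_type by <:].
HB.instance Definition _ :=
  GRing.SubChoice_isSubLmodule.Build K _ _ subalgM_type (subalgM_submod S).

Definition subalgM_mulop (x y : subalgM_type) : subalgM_type :=
  SubalgMType (subalgM_mul (subalgM_valP x) (subalgM_valP y)).

Lemma subalgM_mulA : associative subalgM_mulop.
Proof. by move=> x y z; apply: val_inj; apply: numulA. Qed.

Lemma subalgM_linearl y : linear (subalgM_mulop^~ y).
Proof.
move=> k x x'; apply: val_inj.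
exact: (numul_linearl (subalgM_val y) k (subalgM_val x) (subalgM_val x')).
Qed.

Lemma subalgM_linearr x : linear (subalgM_mulop x).
Proof.
move=> k y y'; apply: val_inj.
exact: (numul_linearr (subalgM_val x) k (subalgM_val y) (subalgM_val y')).
Qed.

HB.instance Definition _ := Lmodule_isNonUnitalAlgebra.Build K subalgM_type
  subalgM_mulA subalgM_linearl subalgM_linearr.

Definition subalgM_nualg : nualgType K := subalgM_type.

End SubalgebraType.

Coercion subalgM_val : subalgM_type >-> multiplier.
Coercion subalgM_nualg : subalgM >-> nualgType.

(* M(B) as a subset of M(A), for B a subalgebra of M(A) with BA = A = AB:
   a multiplier T of B acts on A by T(xa) = (Tx)a and (ax)T = a(xT). *)
Definition mult_of_subalg (K : fieldType) (A : nualgType K) (B : subalgM A) :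
    set (multiplier A) :=
  [set T | exists T' : multiplier (B : nualgType K),
     (forall (x : B) (a : A), T ▷ (x ▷ a) = (T' ▷ x) ▷ a) /\
     (forall (x : B) (a : A), (a ◁ x) ◁ T = a ◁ (x ◁ T'))].

(* (T·ω)(b) = ω(bT) and (ω·T)(b) = ω(Tb). *)
Section DualAction.
Variables (K : fieldType) (A : nualgType K) (T : multiplier A) (w : {scalar A}).

Definition dual_lact_fun (b : A) : K := w (b ◁ T).
Definition dual_ract_fun (b : A) : K := w (T ▷ b).

Lemma dual_lact_linear : scalar dual_lact_fun.
Proof.
have /asboolP[[_ T2] _] := mulvalP T.
by move=> k a b; rewrite /dual_lact_fun /ract T2 linearP.
Qed.

Lemma dual_ract_linear : scalar dual_ract_fun.
Proof.
have /asboolP[[T1 _] _] := mulvalP T.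
by move=> k a b; rewrite /dual_ract_fun /lact T1 linearP.
Qed.

HB.instance Definition _ :=
  GRing.isLinear.Build K A K *%R dual_lact_fun dual_lact_linear.
HB.instance Definition _ :=
  GRing.isLinear.Build K A K *%R dual_ract_fun dual_ract_linear.

Definition dual_lact : {scalar A} := dual_lact_fun.
Definition dual_ract : {scalar A} := dual_ract_fun.

End DualAction.

(* [tens f g] is the quotient of the tensor product of the vector spaces U and V
   by the relations f i u ⊗ v = u ⊗ g i v, constructed as a quotient of the
   vector space with basis U * V. *)
Section BalancedTensor.
Variables (K : fieldType) (U V : lmodType K) (I : Type).
Variables (f : I -> U -> U) (g : I -> V -> V).

Local Notation free := {malg K[(U * V)%type]}.
Local Notation "[ u ; v ]" := (mkmalgU (u, v) 1 : free).

Inductive tens_rel : free -> Prop :=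
| TensRel0 : tens_rel 0
| TensRelD s t : tens_rel s -> tens_rel t -> tens_rel (s + t)
| TensRelZ k t : tens_rel t -> tens_rel (k *: t)
| TensRelLinl k u u' v :
    tens_rel ([k *: u + u'; v] - (k *: [u; v] + [u'; v]))
| TensRelLinr k u v v' :
    tens_rel ([u; k *: v + v'] - (k *: [u; v] + [u; v']))
| TensRelBal i u v : tens_rel ([f i u; v] - [u; g i v]).

Definition tens_pred : {pred free} := fun t => `[< tens_rel t >].

Lemma tens_pred_subproof : subsemimod_closed tens_pred.
Proof.
split; [split|].
- exact/asboolP/TensRel0.
- by move=> s t /asboolP hs /asboolP ht; apply/asboolP/TensRelD.
- by move=> k t /asboolP ht; apply/asboolP/TensRelZ.
Qed.

HB.instance Definition _ :=
  GRing.isSubmodClosed.Build K free tens_pred tens_pred_subproof.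

Definition tens : Type := Quotient.quot (tens_pred : zmodClosed free).

HB.instance Definition _ := GRing.Zmodule.on tens.

Definition tens_pi (t : free) : tens := \pi_(Quotient.quot tens_pred) t.
Definition tens_repr (t : tens) : free := repr t.

Lemma tens_reprK : cancel tens_repr tens_pi.
Proof. exact: reprK. Qed.

Lemma tens_pi_eq s t : tens_pi s = tens_pi t <-> tens_rel (s - t).
Proof.
split=> [/eqP|st]; first by rewrite -Quotient.idealrBE => /asboolP.
by apply/eqP; rewrite -Quotient.idealrBE; apply/asboolP.
Qed.

Lemma tens_piD s t : tens_pi (s + t) = tens_pi s + tens_pi t.
Proof. exact: (raddfD \pi_(Quotient.quot tens_pred)). Qed.

Definition tens_scale (k : K) (t : tens) : tens := tens_pi (k *: tens_repr t).

Lemma tens_piZ k t : tens_pi (k *: t) = tens_scale k (tens_pi t).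
Proof.
apply/tens_pi_eq; rewrite -scalerBr; apply/TensRelZ/tens_pi_eq.
by rewrite tens_reprK.
Qed.

Lemma tens_scaleA a b t : tens_scale a (tens_scale b t) = tens_scale (a * b) t.
Proof. by rewrite -[t]tens_reprK -!tens_piZ scalerA. Qed.

Lemma tens_scale1 : left_id 1 tens_scale.
Proof. by move=> t; rewrite -[t]tens_reprK -tens_piZ scale1r. Qed.

Lemma tens_scaleDr : right_distributive tens_scale +%R.
Proof.
move=> k s t; rewrite -[s]tens_reprK -[t]tens_reprK.
by rewrite -tens_piD -!tens_piZ scalerDr tens_piD.
Qed.

Lemma tens_scaleDl t : {morph tens_scale^~ t : a b / a + b}.
Proof.
by move=> a b; rewrite /= -[t]tens_reprK -!tens_piZ scalerDl tens_piD.
Qed.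

HB.instance Definition _ := GRing.Zmodule_isLmodule.Build K tens
  tens_scaleA tens_scale1 tens_scaleDr tens_scaleDl.

Definition tpure (u : U) (v : V) : tens := tens_pi [u; v].

Lemma tpure_linearl v : linear (tpure^~ v).
Proof.
move=> k u u'; rewrite -[k *: tpure u v]/(tens_scale _ _) -tens_piZ -tens_piD.
exact/tens_pi_eq/TensRelLinl.
Qed.

Lemma tpure_linearr u : linear (tpure u).
Proof.
move=> k v v'; rewrite -[k *: tpure u v]/(tens_scale _ _) -tens_piZ -tens_piD.
exact/tens_pi_eq/TensRelLinr.
Qed.

Lemma tpure_bal i u v : tpure (f i u) v = tpure u (g i v).
Proof. exact/tens_pi_eq/TensRelBal. Qed.

(* The linear map on the tensor product induced by F, computed on a chosen
   representative; by [tlift_pure] and [tlift_linear] below it is the map given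
   by the universal property when F is bilinear and balanced, the only case in
   which it is meaningful. *)
Definition tlift (W : lmodType K) (F : U -> V -> W) (t : tens) : W :=
  \sum_(p <- msupp (tens_repr t)) (tens_repr t)@_p *: F p.1 p.2.

Section Universal.
Variables (W : lmodType K) (F : U -> V -> W).
Hypothesis Fl : forall v, linear (F^~ v).
Hypothesis Fr : forall u, linear (F u).
Hypothesis Fbal : forall i u v, F (f i u) v = F u (g i v).

Let L (s : free) : W := \sum_(p <- msupp s) s@_p *: F p.1 p.2.

Let LE (d : {fset U * V}) s : (msupp s `<=` d)%fset ->
  L s = \sum_(p <- d) s@_p *: F p.1 p.2.
Proof.
move=> sd; rewrite /L (big_fset_incl _ sd) // => p _.
by move=> /mcoeff_outdom ->; rewrite scale0r.
Qed.

Let LP k s t : L (k *: s + t) = k *: L s + L t.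
Proof.
pose d := (msupp s `|` msupp t `|` msupp (k *: s + t))%fset.
have ds : (msupp s `<=` d)%fset by rewrite /d -fsetUA fsubsetUl.
have dt : (msupp t `<=` d)%fset by rewrite /d fsetUAC fsubsetUr.
have dst : (msupp (k *: s + t) `<=` d)%fset by rewrite /d fsubsetUr.
rewrite (LE ds) (LE dt) (LE dst) scaler_sumr -big_split.
by apply: eq_bigr => p _ /=; rewrite mcoeffD mcoeffZ scalerDl scalerA.
Qed.

Let LU u v : L [u; v] = F u v.
Proof. by rewrite /L msuppU oner_eq0 big_seq_fset1 mcoeffUU scale1r. Qed.

Let L0 s : tens_rel s -> L s = 0.
Proof.
have L00 : L 0 = 0 by rewrite /L msupp0 big_seq_fset0.
have LD s' t' : L (s' + t') = L s' + L t'.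
  by have := LP 1 s' t'; rewrite !scale1r.
have LZ k s' : L (k *: s') = k *: L s'.
  by have := LP k s' 0; rewrite L00 !addr0.
have LB s' t' : L (s' - t') = L s' - L t'.
  by rewrite -[- t']scaleN1r LD LZ scaleN1r.
elim=> [|s' t' _ hs _ ht|k t' _ ht|k u u' v|k u v v'|i u v] //.
- by rewrite LD hs ht addr0.
- by rewrite LZ ht scaler0.
- by rewrite LB LD LZ !LU Fl subrr.
- by rewrite LB LD LZ !LU Fr subrr.
- by rewrite LB !LU Fbal subrr.
Qed.

Let Lpi s : tlift F (tens_pi s) = L s.
Proof.
rewrite -/(L _); have /L0 : tens_rel (tens_repr (tens_pi s) - s).
  by apply/tens_pi_eq; rewrite tens_reprK.
rewrite addrC -scaleN1r LP scaleN1r => /eqP.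
by rewrite addrC subr_eq0 => /eqP.
Qed.

Lemma tlift_pure u v : tlift F (tpure u v) = F u v.
Proof. by rewrite Lpi LU. Qed.

Lemma tlift_linear : linear (tlift F).
Proof.
move=> k s t; rewrite -[s]tens_reprK -[t]tens_reprK.
by rewrite -[k *: _]/(tens_scale _ _) -tens_piZ -tens_piD !Lpi LP.
Qed.

End Universal.

End BalancedTensor.

Arguments tpure {K U V I f g} u v.
Arguments tlift {K U V I f g W} F t.
Notation "u ⊗ v" := (tpure u v) (at level 45, left associativity) : nualg_scope.

(* Modules over B are vector spaces with a bilinear associative action; as B need
   not have a unit, no unitality is imposed, neither here nor in flatness. *)
Section Flatness.
Variables (K : fieldType) (B : nualgType K).

Definition is_left_module (N : lmodType K) (l : B -> N -> N) : Prop :=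
  [/\ forall n, linear (l^~ n), forall x, linear (l x) &
      forall x y n, l (x ** y) n = l x (l y n)].

Definition is_right_module (N : lmodType K) (r : N -> B -> N) : Prop :=
  [/\ forall x, linear (r^~ x), forall n, linear (r n) &
      forall n x y, r n (x ** y) = r (r n x) y].

Definition flat_left_module (M : lmodType K) (l : B -> M -> M) : Prop :=
  forall (N N' : lmodType K) (r : N -> B -> N) (r' : N' -> B -> N'),
    is_right_module r -> is_right_module r' ->
  forall h : {linear N -> N'}, (forall n x, h (r n x) = r' (h n) x) ->
    injective h ->
  injective (fun t : tens (fun x n => r n x) l =>
    tlift (fun n m => (h n ⊗ m : tens (fun x n' => r' n' x) l)) t).

Definition flat_right_module (M : lmodType K) (r : M -> B -> M) : Prop :=
  forall (N N' : lmodType K) (l : B -> N -> N) (l' : B -> N' -> N'),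
    is_left_module l -> is_left_module l' ->
  forall h : {linear N -> N'}, (forall x n, h (l x n) = l' x (h n)) ->
    injective h ->
  injective (fun t : tens (fun x m => r m x) l =>
    tlift (fun m n => (m ⊗ h n : tens (fun x m' => r m' x) l')) t).

End Flatness.

Record antiiso (K : fieldType) (B C : nualgType K) := AntiIso {
  antiiso_fun :> {linear B -> C};
  antiiso_inv : C -> B;
  antiiso_funK : cancel antiiso_fun antiiso_inv;
  antiiso_invK : cancel antiiso_inv antiiso_fun;
  antiiso_mul : forall x y,
    antiiso_fun (x ** y) = antiiso_fun y ** antiiso_fun x }.

(* F(X,Y) = A, where F(X,Y) denotes the linear span of the values of F. *)
Definition spans (K : fieldType) (X Y A : lmodType K) (F : X -> Y -> A) : Prop :=
  forall a : A, exists s : seq (X * Y)%type, a = \sum_(p <- s) F p.1 p.2.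

Definition has_right_local_units (K : fieldType) (A : nualgType K) : Prop :=
  forall s : seq A, exists e : A, forall a, a \in s -> a ** e = a.
Definition has_left_local_units (K : fieldType) (A : nualgType K) : Prop :=
  forall s : seq A, exists e : A, forall a, a \in s -> e ** a = a.

Definition lact_sub (K : fieldType) (A : nualgType K) (B : subalgM A)
    (x : B) (a : A) : A := x ▷ a.
Definition ract_sub (K : fieldType) (A : nualgType K) (B : subalgM A)
    (a : A) (x : B) : A := a ◁ x.
Arguments lact_sub {K A} B x a.
Arguments ract_sub {K A} B a x.

Record qgraph (K : fieldType) := QGraph {
  qA :> nualgType K;
  qB : subalgM qA;
  qC : subalgM qA;
  SB : antiiso qB qC;
  SC : antiiso qC qB;
  qA_nondegenerate : nondegenerate qA;
  qBC_commute : forall (x : qB) (y : qC),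
    (x : multiplier qA) ** (y : multiplier qA) =
    (y : multiplier qA) ** (x : multiplier qA);
  qBA : spans (lact_sub qB);
  qAB : spans (ract_sub qB);
  qCA : spans (lact_sub qC);
  qAC : spans (ract_sub qC);
  q_left : has_right_local_units qA \/
    (flat_left_module (lact_sub qB) /\ flat_left_module (lact_sub qC));
  q_right : has_left_local_units qA \/
    (flat_right_module (ract_sub qB) /\ flat_right_module (ract_sub qC)) }.

Section TensorSquares.
Variables (K : fieldType) (G : qgraph K).
Implicit Types (a b : G) (x : qB G) (y : qC G).

Definition tensB : lmodType K := (* ax ⊗ b = a ⊗ xb *)
  tens (fun x a => a ◁ x) (fun x b => x ▷ b).
Definition tensC : lmodType K := (* ay ⊗ b = a ⊗ yb *)
  tens (fun y a => a ◁ y) (fun y b => y ▷ b).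
Definition tens_upB : lmodType K := (* xa ⊗ b = a ⊗ bx *)
  tens (fun x a => x ▷ a) (fun x b => b ◁ x).
Definition tens_upC : lmodType K := (* ya ⊗ b = a ⊗ by *)
  tens (fun y a => y ▷ a) (fun y b => b ◁ y).

(* xa ⊗ b = a ⊗ S_B(x)b *)
Definition fl x a := x ▷ a.
Definition gl x b := SB G x ▷ b.
Definition tensl : lmodType K := tens fl gl.

(* aS_C(y) ⊗ b = a ⊗ by *)
Definition fr y a := a ◁ SC G y.
Definition gr y b := b ◁ y.
Definition tensr : lmodType K := tens fr gr.

End TensorSquares.

(* The triple tensor product of A, with the first two factors balanced by (f, g)
   and the last two by (f', g'), bracketed to the left; [tcons a t] is a ⊗ t. *)
Section TripleTensor.
Variables (K : fieldType) (A : lmodType K) (I J : Type).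
Variables (f : I -> A -> A) (g : I -> A -> A).
Variables (f' : J -> A -> A) (g' : J -> A -> A).

Definition tens3 : lmodType K :=
  tens (fun j (t : tens f g) => tlift (fun a b => (a ⊗ f' j b : tens f g)) t) g'.

Definition tcons (a : A) (t : tens f' g') : tens3 :=
  tlift (fun b c => ((a ⊗ b : tens f g) ⊗ c : tens3)) t.

End TripleTensor.

Arguments tcons {K A I J f g f' g'} a t.

Section TripleTensorGraph.
Variables (K : fieldType) (G : qgraph K).

Definition tensll : lmodType K := tens3 (@fl K G) (@gl K G) (@fl K G) (@gl K G).
Definition tenslr : lmodType K := tens3 (@fl K G) (@gl K G) (@fr K G) (@gr K G).
Definition tensrl : lmodType K := tens3 (@fr K G) (@gr K G) (@fl K G) (@gl K G).
Definition tensrr : lmodType K := tens3 (@fr K G) (@gr K G) (@fr K G) (@gr K G).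

End TripleTensorGraph.

(* [DB a] is the endomorphism Δ_B(a), [DBl a b] and [DBr a b] are the elements
   Δ_B(a)(b ⊗ 1) and Δ_B(a)(1 ⊗ b). As these elements, hence the canonical maps,
   are to depend on Δ_B only, they are required to be the unique ones with the
   stated property; this is automatic when A has right local units. *)
Record left_comult (K : fieldType) (G : qgraph K) := LeftComult {
  DB : G -> tensl G -> tensl G;
  DBl : G -> G -> tensl G;
  DBr : G -> G -> tensl G;
  DB_end : forall a, linear (DB a);
  DB_linear : forall t, linear (DB^~ t);
  DB_mul : forall a b t, DB (a ** b) t = DB a (DB b t);
  DB_r : forall a b c : G,
    DB a (b ⊗ c : tensl G) = tlift (fun p q => (p ** b ⊗ q : tensl G)) (DBr a c);
  DB_l : forall a b c : G,
    DB a (b ⊗ c : tensl G) = tlift (fun p q => (p ⊗ q ** c : tensl G)) (DBl a b);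
  DBr_unique : forall (a c : G) (t : tensl G),
    (forall b : G,
      DB a (b ⊗ c : tensl G) = tlift (fun p q => (p ** b ⊗ q : tensl G)) t) ->
    t = DBr a c;
  DBl_unique : forall (a b : G) (t : tensl G),
    (forall c : G,
      DB a (b ⊗ c : tensl G) = tlift (fun p q => (p ⊗ q ** c : tensl G)) t) ->
    t = DBl a b;
  DB_bimod : forall (x x' : qB G) (y y' : qC G) (a : G) (t : tensl G),
    DB (x ▷ (y ▷ a ◁ x' ◁ y')) t =
    tlift (fun p q => (y ▷ p ⊗ x ▷ q : tensl G))
      (DB a (tlift (fun p q => (y' ▷ p ⊗ x' ▷ q : tensl G)) t));
  DB_coassoc : forall a b c : G,
    tlift (fun p q => (DBl p a ⊗ q : tensll G)) (DBr b c) =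
    tlift (fun p q => (tcons p (DBr q c) : tensll G)) (DBl b a) }.

(* [DC c t] is t Δ_C(c), the endomorphisms acting from the right; [DCl a b] and
   [DCr a b] are the elements (b ⊗ 1)Δ_C(a) and (1 ⊗ b)Δ_C(a), required to be unique as above. *)
Record right_comult (K : fieldType) (G : qgraph K) := RightComult {
  DC : G -> tensr G -> tensr G;
  DCl : G -> G -> tensr G;
  DCr : G -> G -> tensr G;
  DC_end : forall a, linear (DC a);
  DC_linear : forall t, linear (DC^~ t);
  DC_mul : forall a b t, DC (a ** b) t = DC b (DC a t);
  DC_l : forall a b c : G,
    DC c (a ⊗ b : tensr G) = tlift (fun p q => (p ⊗ b ** q : tensr G)) (DCl c a);
  DC_r : forall a b c : G,
    DC c (a ⊗ b : tensr G) = tlift (fun p q => (a ** p ⊗ q : tensr G)) (DCr c b);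
  DCl_unique : forall (a c : G) (t : tensr G),
    (forall b : G,
      DC c (a ⊗ b : tensr G) = tlift (fun p q => (p ⊗ b ** q : tensr G)) t) ->
    t = DCl c a;
  DCr_unique : forall (b c : G) (t : tensr G),
    (forall a : G,
      DC c (a ⊗ b : tensr G) = tlift (fun p q => (a ** p ⊗ q : tensr G)) t) ->
    t = DCr c b;
  DC_bimod : forall (x x' : qB G) (y y' : qC G) (a : G) (t : tensr G),
    DC (x ▷ (y ▷ a ◁ x' ◁ y')) t =
    tlift (fun p q => (p ◁ y' ⊗ q ◁ x' : tensr G))
      (DC a (tlift (fun p q => (p ◁ y ⊗ q ◁ x : tensr G)) t));
  DC_coassoc : forall a b c : G,
    tlift (fun p q => (DCl p a ⊗ q : tensrr G)) (DCr b c) =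
    tlift (fun p q => (tcons p (DCr q c) : tensrr G)) (DCl b a) }.

Record bialgebroid (K : fieldType) := Bialgebroid {
  bgraph :> qgraph K;
  bleft : left_comult bgraph;
  bright : right_comult bgraph;
  b_compat_lr : forall a b c : bgraph,
    tlift (fun p q => (DBl bleft p a ⊗ q : tenslr bgraph)) (DCr bright b c) =
    tlift (fun p q => (tcons p (DCr bright q c) : tenslr bgraph)) (DBl bleft b a);
  b_compat_rl : forall a b c : bgraph,
    tlift (fun p q => (DCl bright p a ⊗ q : tensrl bgraph)) (DBr bleft b c) =
    tlift (fun p q => (tcons p (DBr bleft q c) : tensrl bgraph)) (DCl bright b a) }.

Section Bialgebroid.
Variables (K : fieldType) (H : bialgebroid K).

(* The canonical maps T_λ, T_ρ, _λT and _ρT, in this order. *)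
Definition can_Tl (t : tens_upC H) : tensl H :=
  tlift (fun a b => DBl (bleft H) b a) t.
Definition can_Tr (t : tensB H) : tensl H :=
  tlift (fun a b => DBr (bleft H) a b) t.
Definition can_lT (t : tensC H) : tensr H :=
  tlift (fun a b => DCl (bright H) b a) t.
Definition can_rT (t : tens_upB H) : tensr H :=
  tlift (fun a b => DCr (bright H) a b) t.

Definition is_regular_hopf : Prop :=
  [/\ bijective can_Tl, bijective can_Tr, bijective can_lT & bijective can_rT].

Definition is_flat : Prop :=
  [/\ flat_left_module (lact_sub (qB H)), flat_right_module (ract_sub (qB H)),
      flat_left_module (lact_sub (qC H)) & flat_right_module (ract_sub (qC H))].

End Bialgebroid.

Record regular_mult_hopf_algebroid (K : fieldType) := RegularMultHopfAlgebroid {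
  hopf_bialgebroid :> bialgebroid K;
  hopf_regular : is_regular_hopf hopf_bialgebroid }.

Section Integrals.
Variables (K : fieldType) (H : regular_mult_hopf_algebroid K).
Implicit Types (a b : H) (x : qB H) (y : qC H).

Record is_left_counit (eB : {linear H -> qB H}) : Prop := IsLeftCounit {
  eB_lact : forall x a, eB (x ▷ a) = x ** eB a;
  eB_SB : forall x a, eB (SB H x ▷ a) = eB a ** x;
  eB_counit1 : forall a b,
    tlift (fun p q => SB H (eB p) ▷ q) (DBr (bleft H) a b) = a ** b;
  eB_counit2 : forall a b,
    tlift (fun p q => eB q ▷ p) (DBl (bleft H) b a) = b ** a;
  eB_mul : forall a b, eB (a ** b) = eB (a ◁ eB b);
  eB_mulS : forall a b, eB (a ** b) = eB (a ◁ SB H (eB b)) }.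

Record is_right_counit (eC : {linear H -> qC H}) : Prop := IsRightCounit {
  eC_ract : forall y a, eC (a ◁ y) = eC a ** y;
  eC_SC : forall y a, eC (a ◁ SC H y) = y ** eC a;
  eC_counit1 : forall a b,
    tlift (fun p q => q ◁ eC p) (DCr (bright H) a b) = b ** a;
  eC_counit2 : forall a b,
    tlift (fun p q => p ◁ SC H (eC q)) (DCl (bright H) b a) = a ** b;
  eC_mul : forall a b, eC (a ** b) = eC (eC a ▷ b);
  eC_mulS : forall a b, eC (a ** b) = eC (SC H (eC a) ▷ b) }.

Variables (eB : {linear H -> qB H}) (eC : {linear H -> qC H}).

Record is_base_weight (muB : {scalar qB H}) (muC : {scalar qC H}) : Prop :=
  IsBaseWeight {
  muB_faithful : faithful_functional muB;
  muC_faithful : faithful_functional muC;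
  muB_SC : forall y, muB (SC H y) = muC y;
  muC_SB : forall x, muC (SB H x) = muB x;
  mu_counit : forall a, muB (eB a) = muC (eC a) }.

Variables (muB : {scalar qB H}) (muC : {scalar qC H}).

(* Bw, wB, Cw, wC stand for _Bω, ω_B, _Cω, ω_C; they are uniquely determined
   by w because muB and muC are faithful. *)
Record adapted_by (w : {scalar H}) (Bw wB : H -> qB H) (Cw wC : H -> qC H) :
    Prop := AdaptedBy {
  adapted_Bl : forall x a, w (x ▷ a) = muB (x ** Bw a);
  adapted_Br : forall x a, w (a ◁ x) = muB (wB a ** x);
  adapted_Cl : forall y a, w (y ▷ a) = muC (y ** Cw a);
  adapted_Cr : forall y a, w (a ◁ y) = muC (wC a ** y) }.

(* Invariance: Σ S_B^-1(Cphi(b_(2))) b_(1) a = Cphi(b) a. *)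
Definition left_integral (phi : {scalar H}) : Prop :=
  exists Bphi phiB Cphi phiC, adapted_by phi Bphi phiB Cphi phiC /\
    forall a b,
      tlift (fun p q => antiiso_inv (SB H) (Cphi q) ▷ p) (DBl (bleft H) b a) =
      Cphi b ▷ a.

(* Invariance: Σ S_B(Bpsi(a_(1))) a_(2) b = Bpsi(a) b. *)
Definition right_integral (psi : {scalar H}) : Prop :=
  exists Bpsi psiB Cpsi psiC, adapted_by psi Bpsi psiB Cpsi psiC /\
    forall a b,
      tlift (fun p q => SB H (Bpsi p) ▷ q) (DBr (bleft H) a b) = Bpsi a ▷ b.

Definition full_left_integral (phi : {scalar H}) : Prop :=
  left_integral phi /\
  exists Bphi phiB Cphi phiC, adapted_by phi Bphi phiB Cphi phiC /\
    (forall x, exists a, Bphi a = x) /\ (forall x, exists a, phiB a = x).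

Definition full_right_integral (psi : {scalar H}) : Prop :=
  right_integral psi /\
  exists Bpsi psiB Cpsi psiC, adapted_by psi Bpsi psiB Cpsi psiC /\
    (forall y, exists a, Cpsi a = y) /\ (forall y, exists a, psiC a = y).

End Integrals.

(* Main.v *)
Require Import Defs.
From mathcomp Require Import all_boot all_order all_algebra.
From mathcomp Require Import finmap monalg.
From mathcomp Require Import boolp classical_sets reals complex.

(** Let [phi] be a full and faithful left integral, [psi] a full and faithful
    right integral and [w] any left integral.

    Comparison with [psi].  Slicing a tensor of [A ⊗_l A] by [psi] in the first
    leg and applying [phi] is the same as slicing it by [phi] in the second leg
    and applying [psi] (slice_exchange).  For
    [t = sum Δ_B(c_i)(1 ⊗ d_i) = sum Δ_B(e_j)(f_j ⊗ 1)] the two invariances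
    evaluate both sides at [Δ_B(x) t] and give
    [psi (x (sum c_i phi_B(d_i))) = phi (x (sum e_j psi_C(f_j)))].  As the
    canonical maps, [phi_B] and [psi_C] are onto, both sums are arbitrary elements
    of [A], so that for each [e] there is [e'] with [w (x e) = phi (x e')] for
    all [x] (left_to_left); the mirror image, for [Δ_C], is
    [w (e x) = phi (e' x)].

    From [A] to the base.  If [w (e x) = phi (e' x)] for all [x], then the slice
    of [Δ_B(e)(1 ⊗ x)] by [w] equals that of [Δ_B(e')(1 ⊗ x)] by [phi], and [psi]
    of these slices is [w (psi_B(e) x)] and [phi (psi_B(e') x)] (left_transfer).
    Since [psi_B] is onto (right_surjective), there is a map [b |-> T b] on [B]
    with [w (b x) = phi ((T b) x)].

    From half a multiplier to a multiplier.  The base weight has the modular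
    automorphism [sigma = S_C S_B], that is, [mu_B (u x) = mu_B (sigma(x) u)]
    (muB_modular).  Rewriting [w] and [phi] through their [B]-valued versions,
    the last equality becomes [sigma(w_B(x)) b = sigma(phi_B(x)) (T b)]; as
    [phi_B] is onto, [sigma(phi_B(x)) |-> sigma(w_B(x))] is the missing right half
    of a multiplier [T] of [B], and [w = phi · T] (left_integral_mult).
    Conversely, the modular automorphism shows that [phi · T] is adapted, and its
    invariance is immediate (mult_left_integral).

    The first step and the second one use different comultiplications.  Left
    invariance, which is imposed for [Δ_B], passes to [Δ_C] by the mixed
    coassociativity (left_inv_op).

    The algebra [A] need not be spanned by products.  Three arguments therefore
    hold at first only for products, or after multiplication by elements of the
    image [I] of the counit; they extend because [I A ⊆ A A ⊆ A S_B(I)] and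
    because the ideal [I] of [B] has no annihilator (counit_essB, counit_essC).

    There are four equalities to prove, exchanged by two symmetries: passing to
    the opposite algebra, which interchanges [Δ_B] and [Δ_C] and the two sides of
    a functional, and flipping the legs, which interchanges [B] and [C] and left
    and right integrals.  All of the above is carried out for algebraic data
    closed under both symmetries, and is proved for one equality only. *)

Set Implicit Arguments.
Unset Strict Implicit.
Unset Printing Implicit Defensive.

Import GRing.Theory.
Local Open Scope ring_scope.

(** * Linear maps and spanning families *)

Section LinearFunctions.
Variables (K : fieldType) (U V : lmodType K) (f : U -> V).
Hypothesis fL : linear f.

Lemma lin_add u v : f (u + v) = f u + f v.
Proof. by have := fL 1 u v; rewrite !scale1r. Qed.

Lemma lin0 : f 0 = 0.
Proof. by apply: (addIr (f 0)); rewrite -lin_add !add0r. Qed.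

Lemma lin_scale k u : f (k *: u) = k *: f u.
Proof. by have := fL k u 0; rewrite lin0 !addr0. Qed.

Lemma lin_sub u v : f (u - v) = f u - f v.
Proof. by rewrite -scaleN1r lin_add lin_scale scaleN1r. Qed.

Lemma lin_sum (I : Type) (s : seq I) (F : I -> U) :
  f (\sum_(i <- s) F i) = \sum_(i <- s) f (F i).
Proof.
elim: s => [|i s IH]; first by rewrite !big_nil lin0.
by rewrite !big_cons lin_add IH.
Qed.

Lemma lin_comp (W : lmodType K) (g : W -> U) :
  linear g -> linear (fun w => f (g w)).
Proof. by move=> gL k u v; rewrite gL fL. Qed.

End LinearFunctions.

Lemma spans_ext (K : fieldType) (X Y U V : lmodType K) (h : X -> Y -> U)
    (f g : U -> V) :
  spans h -> linear f -> linear g ->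
  (forall x y, f (h x y) = g (h x y)) -> f =1 g.
Proof.
move=> hS fL gL fg u; have [s ->] := hS u.
by rewrite (lin_sum fL) (lin_sum gL); apply: eq_bigr => p _.
Qed.

Lemma spans_vanish (K : fieldType) (X Y U V : lmodType K) (h : X -> Y -> U)
    (f : U -> V) :
  spans h -> linear f -> (forall x y, f (h x y) = 0) -> forall u, f u = 0.
Proof.
move=> hS fL f0; apply: (spans_ext hS fL) => // k u v.
by rewrite scaler0 addr0.
Qed.

Lemma spans_ind (K : fieldType) (X Y U : lmodType K) (h : X -> Y -> U)
    (Q : U -> Prop) :
  spans h -> Q 0 -> (forall u v, Q u -> Q v -> Q (u + v)) ->
  (forall x y, Q (h x y)) -> forall u, Q u.
Proof.
move=> hS Q0 QD Qh u; have [s ->] := hS u.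
by elim: s => [|p s IH]; rewrite ?big_nil // big_cons; apply: QD.
Qed.

(** * Frames and comultiplications *)

(** The algebra [A] with the two commuting algebras of the base acting on it
    from both sides; [rB x a] stands for [a x], so that the left and the right
    actions have the same type.  The operations are plain functions, and the
    projections are primitive, so that passing twice to the opposite is the
    identity by computation. *)
#[projections(primitive)]
Record frame (K : fieldType) := Frame {
  fA : lmodType K; fB : lmodType K; fC : lmodType K;
  mA : fA -> fA -> fA; mB : fB -> fB -> fB; mC : fC -> fC -> fC;
  lB : fB -> fA -> fA; rB : fB -> fA -> fA;
  lC : fC -> fA -> fA; rC : fC -> fA -> fA;
  sB : fB -> fC; sBi : fC -> fB; sC : fC -> fB; sCi : fB -> fC }.

Record bimultiplier (K : fieldType) (A B : lmodType K) (m : A -> A -> A)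
    (mB : B -> B -> B) (l r : B -> A -> A) : Prop := Bimultiplier {
  bm_mull : forall y, linear (mB^~ y);
  bm_mulr : forall x, linear (mB x);
  bm_ll : forall a, linear (l^~ a);
  bm_lr : forall x, linear (l x);
  bm_rl : forall a, linear (r^~ a);
  bm_rr : forall x, linear (r x);
  bm_lM : forall x y a, l (mB x y) a = l x (l y a);
  bm_rM : forall x y a, r (mB x y) a = r y (r x a);
  bm_lA : forall x a b, l x (m a b) = m (l x a) b;
  bm_rA : forall x a b, r x (m a b) = m a (r x b);
  bm_mid : forall x a b, m (r x a) b = m a (l x b);
  bm_lspan : spans l;
  bm_rspan : spans r;
  bm_linj : forall x, (forall a, l x a = 0) -> x = 0;
  bm_rinj : forall x, (forall a, r x a = 0) -> x = 0 }.

Lemma bimultiplier_op (K : fieldType) (A B : lmodType K) (m : A -> A -> A)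
    (mB : B -> B -> B) (l r : B -> A -> A) : bimultiplier m mB l r ->
  bimultiplier (fun a b => m b a) (fun x y => mB y x) r l.
Proof. by case=> *; split. Qed.

Record antiisomorphic (K : fieldType) (B C : lmodType K) (mB : B -> B -> B)
    (mC : C -> C -> C) (s : B -> C) (si : C -> B) : Prop := Antiisomorphic {
  anti_lin : linear s;
  anti_invlin : linear si;
  antiK : cancel s si;
  anti_invK : cancel si s;
  antiM : forall x y, s (mB x y) = mC (s y) (s x);
  anti_invM : forall x y, si (mC x y) = mB (si y) (si x) }.

Record frame_axioms (K : fieldType) (F : frame K) : Prop := FrameAxioms {
  mAl : forall b, linear ((mA (f:=F))^~ b);
  mAr : forall a, linear (@mA _ F a);
  mA_assoc : associative (@mA _ F);
  mA_nondegl : forall a, (forall b, mA a b = 0) -> a = 0 :> fA F;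
  mA_nondegr : forall a, (forall b, mA b a = 0) -> a = 0 :> fA F;
  frameB : bimultiplier (@mA _ F) (@mB _ F) (@lB _ F) (@rB _ F);
  frameC : bimultiplier (@mA _ F) (@mC _ F) (@lC _ F) (@rC _ F);
  lBC : forall x y (a : fA F), lB x (lC y a) = lC y (lB x a);
  rBC : forall x y (a : fA F), rB x (rC y a) = rC y (rB x a);
  frame_sB : antiisomorphic (@mB _ F) (@mC _ F) (@sB _ F) (@sBi _ F);
  frame_sC : antiisomorphic (@mC _ F) (@mB _ F) (@sC _ F) (@sCi _ F) }.

Section FrameSymmetries.
Variables (K : fieldType).
Implicit Types F : frame K.

(** On the opposite algebra the right comultiplication becomes a left one if
    [S_C^-1] takes the place of [S_B]: the relation [a S_C(y) ⊗ b = a ⊗ b y]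
    defining [A ⊗_r A] reads [a x ⊗ b = a ⊗ b S_C^-1(x)] for [x = S_C(y)]. *)
Definition fop F : frame K :=
  Frame (fun a b : fA F => mA b a) (fun x y : fB F => mB y x)
    (fun x y : fC F => mC y x) (@rB _ F) (@lB _ F) (@rC _ F) (@lC _ F)
    (@sCi _ F) (@sC _ F) (@sBi _ F) (@sB _ F).

(** Flipping the legs of [A ⊗_l A] exchanges [B] and [C]: its relation
    [x a ⊗ b = a ⊗ S_B(x) b] reads [y b ⊗ a = b ⊗ S_B^-1(y) a] for
    [y = S_B(x)]. *)
Definition fco F : frame K :=
  Frame (@mA _ F) (@mC _ F) (@mB _ F) (@lC _ F) (@rC _ F) (@lB _ F) (@rB _ F)
    (@sBi _ F) (@sB _ F) (@sCi _ F) (@sC _ F).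

Lemma antiiso_sym (B C : lmodType K) (mB : B -> B -> B) (mC : C -> C -> C)
    (s : B -> C) (si : C -> B) :
  antiisomorphic mB mC s si -> antiisomorphic mC mB si s.
Proof. by case. Qed.

Lemma antiiso_op (B C : lmodType K) (mB : B -> B -> B) (mC : C -> C -> C)
    (s : B -> C) (si : C -> B) : antiisomorphic mB mC s si ->
  antiisomorphic (fun x y => mB y x) (fun x y => mC y x) s si.
Proof. by case=> *; split. Qed.

Lemma fop_axioms F : frame_axioms F -> frame_axioms (fop F).
Proof.
case=> ml mr mAs nl nr fB fC lbc rbc ssB ssC; split=> //.
- by move=> a b c; rewrite /= mAs.
- exact: bimultiplier_op.
- exact: bimultiplier_op.
- exact/antiiso_op/antiiso_sym.
- exact/antiiso_op/antiiso_sym.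
Qed.

Lemma fco_axioms F : frame_axioms F -> frame_axioms (fco F).
Proof.
case=> ml mr mAs nl nr fB fC lbc rbc ssB ssC; split=> //.
- exact/antiiso_sym.
- exact/antiiso_sym.
Qed.

End FrameSymmetries.

(** A comultiplication, with the tensor square in which it takes values:
    [bext G t] is the value at [t] of the linear map extending the balanced map
    [G], and [cD a], [cDl a b], [cDr a b] are [Δ(a)], [Δ(a)(b ⊗ 1)] and
    [Δ(a)(1 ⊗ b)].  Keeping the tensor square abstract lets its flip have the same
    underlying space. *)
Record comul (K : fieldType) (A : lmodType K) := Comul {
  tsq : lmodType K;
  pure : A -> A -> tsq;
  bext : forall V : lmodType K, (A -> A -> V) -> tsq -> V;
  cD : A -> tsq -> tsq;
  cDl : A -> A -> tsq;
  cDr : A -> A -> tsq }.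

Arguments pure {K A} c _ _.
Arguments bext {K A} c {V} _ _.
Arguments cD {K A} c _ _.
Arguments cDl {K A} c _ _.
Arguments cDr {K A} c _ _.

Record balanced (K : fieldType) (F : frame K) (V : lmodType K)
    (G : fA F -> fA F -> V) : Prop := Balanced {
  bal_l : forall b, linear (G^~ b);
  bal_r : forall a, linear (G a);
  bal_m : forall (x : fB F) a b, G (lB x a) b = G a (lC (sB x) b) }.

(** By [bext_sum], [bext G t] is a finite sum even if [G] is not balanced; thus
    linear maps and other sums can be moved through it without conditions.  The
    last two fields say that the canonical maps are onto. *)
Record comul_axioms (K : fieldType) (F : frame K) (X : comul (fA F)) : Prop :=
  ComulAxioms {
  pure_bal : balanced (pure X);
  bext_sum : forall t, exists s : seq (K * (fA F * fA F)),
    forall (V : lmodType K) (G : fA F -> fA F -> V),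
      bext X G t = \sum_(p <- s) p.1 *: G p.2.1 p.2.2;
  bext_id : forall t, bext X (pure X) t = t;
  bext_pure : forall (V : lmodType K) (G : fA F -> fA F -> V),
    balanced G -> forall a b, bext X G (pure X a b) = G a b;
  bext_linear : forall (V : lmodType K) (G : fA F -> fA F -> V),
    balanced G -> linear (bext X G);
  cD_end : forall a, linear (cD X a);
  cD_linear : forall t, linear ((cD X)^~ t);
  cD_mul : forall a b t, cD X (mA a b) t = cD X a (cD X b t);
  cD_r : forall a b c : fA F,
    cD X a (pure X b c) = bext X (fun p q => pure X (mA p b) q) (cDr X a c);
  cD_l : forall a b c : fA F,
    cD X a (pure X b c) = bext X (fun p q => pure X p (mA q c)) (cDl X a b);
  cDr_unique : forall (a c : fA F) t,
    (forall b, cD X a (pure X b c) = bext X (fun p q => pure X (mA p b) q) t) ->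
    t = cDr X a c;
  cDl_unique : forall (a b : fA F) t,
    (forall c, cD X a (pure X b c) = bext X (fun p q => pure X p (mA q c)) t) ->
    t = cDl X a b;
  cD_bimod : forall (x x' : fB F) (y y' : fC F) a t,
    cD X (lB x (lC y (rB x' (rC y' a)))) t =
    bext X (fun p q => pure X (lC y p) (lB x q))
      (cD X a (bext X (fun p q => pure X (lC y' p) (lB x' q)) t));
  cDl_gen : forall t, exists s : seq (K * (fA F * fA F)),
    t = \sum_(p <- s) p.1 *: cDl X p.2.2 p.2.1;
  cDr_gen : forall t, exists s : seq (K * (fA F * fA F)),
    t = \sum_(p <- s) p.1 *: cDr X p.2.1 p.2.2 }.

Section Flip.
Variables (K : fieldType) (F : frame K).

Definition flip (A : lmodType K) (X : comul A) : comul A :=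
  @Comul K A (tsq X) (fun a b => pure X b a)
    (fun V G t => bext X (fun a b => G b a) t)
    (cD X) (cDr X) (cDl X).

Lemma balanced_flip (HF : frame_axioms F) (V : lmodType K)
    (G : fA F -> fA F -> V) :
  @balanced K (fco F) V G -> @balanced K F V (fun a b => G b a).
Proof.
case=> Gl Gr Gm; split=> // x a b.
by have /= := Gm (sB x) b a; rewrite (antiK (frame_sB HF)).
Qed.

Lemma flip_balanced (HF : frame_axioms F) (V : lmodType K)
    (G : fA F -> fA F -> V) :
  @balanced K F V G -> @balanced K (fco F) V (fun a b => G b a).
Proof.
case=> Gl Gr Gm; split=> // y a b.
by have /= := Gm (sBi y) b a; rewrite (anti_invK (frame_sB HF)).
Qed.

Lemma flip_axioms (X : comul (fA F)) : frame_axioms F -> comul_axioms X ->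
  @comul_axioms K (fco F) (flip X).
Proof.
move=> HF [pb ls lid lp ll De Dlin Dm Dr Dl Dru Dlu Dbi Sl Sr].
split=> //=.
- exact: flip_balanced.
- move=> t; have [s Hs] := ls t.
  exists (map (fun p => (p.1, (p.2.2, p.2.1))) s) => V G.
  by rewrite Hs big_map.
- by move=> V G /(balanced_flip HF) HG a b; rewrite lp.
- by move=> V G /(balanced_flip HF) HG; apply: ll.
- by move=> y y' x x' a t; have := Dbi x x' y y' a t;
     rewrite (lBC HF) (rBC HF).
- move=> t; have [s ->] := Sr t.
  by exists (map (fun p => (p.1, (p.2.2, p.2.1))) s); rewrite big_map.
- move=> t; have [s ->] := Sl t.
  by exists (map (fun p => (p.1, (p.2.2, p.2.1))) s); rewrite big_map.
Qed.

End Flip.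

Local Notation "a · b" := (mA a b) (at level 40, left associativity).

Section BalancedExtension.
Variables (K : fieldType) (F : frame K) (X : comul (fA F)).
Hypotheses (HF : frame_axioms F) (HX : comul_axioms X).

Lemma bext_lin (V V' : lmodType K) (L : V -> V') (G : fA F -> fA F -> V) t :
  linear L -> L (bext X G t) = bext X (fun a b => L (G a b)) t.
Proof.
move=> LL; have [s Hs] := bext_sum HX t.
by rewrite !Hs (lin_sum LL); apply: eq_bigr => p _; rewrite (lin_scale LL).
Qed.

Lemma bext_exchange (F' : frame K) (X' : comul (fA F')) (V : lmodType K)
    (G : fA F -> fA F -> fA F' -> fA F' -> V) t t' :
  comul_axioms X' ->
  bext X (fun a b => bext X' (fun c d => G a b c d) t') t =
  bext X' (fun c d => bext X (fun a b => G a b c d) t) t'.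
Proof.
move=> HX'; have [s Hs] := bext_sum HX t; have [s' Hs'] := bext_sum HX' t'.
rewrite Hs Hs'.
under eq_bigr do rewrite Hs' scaler_sumr.
under [RHS]eq_bigr do rewrite Hs scaler_sumr.
rewrite exchange_big; apply: eq_bigr => p _; apply: eq_bigr => q _.
by rewrite !scalerA mulrC.
Qed.

Lemma bext_pureE (V : lmodType K) (L : tsq X -> V) t :
  linear L -> bext X (fun a b => L (pure X a b)) t = L t.
Proof. by move=> LL; rewrite -{2}[t](bext_id HX) (bext_lin _ _ LL). Qed.

Lemma pure_ext (V : lmodType K) (f g : tsq X -> V) :
  linear f -> linear g -> (forall a b, f (pure X a b) = g (pure X a b)) ->
  f =1 g.
Proof.
move=> fL gL fg t; rewrite -(bext_pureE t fL) -(bext_pureE t gL).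
by congr (bext X _ t); apply: funext => a; apply: funext => b.
Qed.

Lemma eq_bext (V : lmodType K) (G G' : fA F -> fA F -> V) t :
  (forall a b, G a b = G' a b) -> bext X G t = bext X G' t.
Proof.
by move=> GG; congr (bext X _ t); apply: funext => a; apply: funext => b.
Qed.

Lemma cD_0 t : cD X 0 t = 0. Proof. exact: (lin0 (cD_linear HX t)). Qed.

End BalancedExtension.

Section FrameTheory.
Variables (K : fieldType) (F : frame K).
Hypothesis HF : frame_axioms F.
Let HB := frameB HF.
Let HC := frameC HF.

Lemma lB_rC x y (a : fA F) : lB x (rC y a) = rC y (lB x a).
Proof.
apply/eqP; rewrite -subr_eq0; apply/eqP/(mA_nondegl HF) => b.
rewrite (lin_sub (mAl HF b)) -(bm_lA HB) (bm_mid HC) (bm_lA HB) (bm_mid HC).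
exact: subrr.
Qed.

Lemma lC_rB x y (a : fA F) : lC y (rB x a) = rB x (lC y a).
Proof.
apply/eqP; rewrite -subr_eq0; apply/eqP/(mA_nondegl HF) => b.
rewrite (lin_sub (mAl HF b)) -(bm_lA HC) (bm_mid HB) (bm_lA HC) (bm_mid HB).
exact: subrr.
Qed.

Lemma lB_rB x x' (a : fA F) : lB x (rB x' a) = rB x' (lB x a).
Proof.
apply/eqP; rewrite -subr_eq0; apply/eqP/(mA_nondegl HF) => b.
rewrite (lin_sub (mAl HF b)) -(bm_lA HB) (bm_mid HB) (bm_lA HB) (bm_mid HB).
exact: subrr.
Qed.

Lemma lC_rC y y' (a : fA F) : lC y (rC y' a) = rC y' (lC y a).
Proof.
apply/eqP; rewrite -subr_eq0; apply/eqP/(mA_nondegl HF) => b.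
rewrite (lin_sub (mAl HF b)) -(bm_lA HC) (bm_mid HC) (bm_lA HC) (bm_mid HC).
exact: subrr.
Qed.

Definition frame_lin :=
  (mAl HF, mAr HF, bm_ll HB, bm_lr HB, bm_rl HB, bm_rr HB, bm_ll HC, bm_lr HC,
   bm_rl HC, bm_rr HC, bm_mull HB, bm_mulr HB, bm_mull HC, bm_mulr HC,
   anti_lin (frame_sB HF), anti_invlin (frame_sB HF), anti_lin (frame_sC HF),
   anti_invlin (frame_sC HF)).

Lemma mB_assoc : associative (@mB _ F).
Proof.
move=> x y z; apply/eqP; rewrite -subr_eq0; apply/eqP/(bm_linj HB) => a.
by rewrite (lin_sub (bm_ll HB a)) !(bm_lM HB) subrr.
Qed.

Lemma mA_cancell (a a' : fA F) : (forall b, a · b = a' · b) -> a = a'.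
Proof.
move=> aa'; apply/eqP; rewrite -subr_eq0; apply/eqP/(mA_nondegl HF) => b.
by rewrite (lin_sub (mAl HF b)) aa' subrr.
Qed.

Lemma lB_inj (x x' : fB F) : (forall a : fA F, lB x a = lB x' a) -> x = x'.
Proof.
move=> xx'; apply/eqP; rewrite -subr_eq0; apply/eqP/(bm_linj HB) => b.
by rewrite (lin_sub (bm_ll HB b)) xx' subrr.
Qed.

End FrameTheory.

Lemma lC_inj (K : fieldType) (F : frame K) : frame_axioms F ->
  forall y y' : fC F, (forall a : fA F, lC y a = lC y' a) -> y = y'.
Proof. by move=> /fco_axioms/lB_inj. Qed.

Lemma mC_assoc (K : fieldType) (F : frame K) : frame_axioms F ->
  associative (@mC _ F).
Proof. by move=> /fco_axioms/mB_assoc. Qed.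

(* Linearity of a function built from the operations of a frame. *)
Ltac flin HF := move=> ? ? ?; rewrite ?(frame_lin HF).

Section ComulTheory.
Variables (K : fieldType) (F : frame K) (X : comul (fA F)).
Hypotheses (HF : frame_axioms F) (HX : comul_axioms X).
Let HB := frameB HF.
Let HC := frameC HF.

Lemma balanced_pure (f g : fA F -> fA F) : linear f -> linear g ->
  (forall x a, f (lB x a) = lB x (f a)) ->
  (forall y a, g (lC y a) = lC y (g a)) ->
  balanced (fun p q => pure X (f p) (g q)).
Proof.
move=> fL gL fB gC; have [pl pr pm] := pure_bal HX.
by split=> [b k u v|a k u v|x a b]; rewrite ?fL ?gL ?pl ?pr ?fB ?gC ?pm.
Qed.

Lemma bext_bext (V : lmodType K) (G : fA F -> fA F -> V) f g t :
  balanced G ->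
  bext X G (bext X (fun p q => pure X (f p) (g q)) t) =
  bext X (fun p q => G (f p) (g q)) t.
Proof.
move=> HG; rewrite (bext_lin HX _ _ (bext_linear HX HG)).
by apply: eq_bext => p q; rewrite (bext_pure HX HG).
Qed.

Lemma balanced_comp (V V' : lmodType K) (L : V -> V')
    (G : fA F -> fA F -> V) :
  linear L -> balanced G -> balanced (fun p q => L (G p q)).
Proof.
move=> LL [Gl Gr Gm]; split=> [b k u v|a k u v|x a b].
- by rewrite Gl LL.
- by rewrite Gr LL.
- by rewrite Gm.
Qed.

Lemma bal_mulr c : balanced (fun p q => pure X p (q · c)).
Proof.
apply: (@balanced_pure id) => //; first by flin HF.
by move=> y a; rewrite (bm_lA HC).
Qed.

Lemma bal_mull c : balanced (fun p q => pure X (p · c) q).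
Proof.
apply: (@balanced_pure _ id) => //; first by flin HF.
by move=> y a; rewrite (bm_lA HB).
Qed.

Lemma bal_lC y : balanced (fun p q => pure X (lC y p) q).
Proof.
apply: (@balanced_pure _ id) => //; first by flin HF.
by move=> x a; rewrite (lBC HF).
Qed.

Lemma bal_lB x : balanced (fun p q => pure X p (lB x q)).
Proof.
apply: (@balanced_pure id) => //; first by flin HF.
by move=> y a; rewrite (lBC HF).
Qed.

(** The uniqueness of the elements [Δ(a)(b ⊗ 1)], used for [a = 0], says that
    right multiplication of the second leg separates the points of the tensor
    square. *)
Lemma tsq_cancelr t t' :
  (forall c, bext X (fun p q => pure X p (q · c)) t =
             bext X (fun p q => pure X p (q · c)) t') -> t = t'.
Proof.
move=> tt'; apply/eqP; rewrite -subr_eq0; apply/eqP.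
have H0 u : (forall c, bext X (fun p q => pure X p (q · c)) u = 0) ->
    u = cDl X 0 0.
  by move=> u0; apply: (cDl_unique HX) => c; rewrite (cD_0 HX) u0.
rewrite (H0 (t - t')).
  by rewrite -(H0 0) // => c; apply/lin0/(bext_linear HX)/bal_mulr.
by move=> c; rewrite (lin_sub (bext_linear HX (bal_mulr c))) tt' subrr.
Qed.

Lemma cDl_linr b : linear (cDl X b).
Proof.
move=> k u v; apply/esym/(cDl_unique HX) => c.
rewrite (bext_linear HX (bal_mulr c)) -!(cD_l HX).
by rewrite (bal_l (pure_bal HX)) (cD_end HX).
Qed.

Lemma cDl_linl a : linear ((cDl X)^~ a).
Proof.
move=> k u v; apply/esym/(cDl_unique HX) => c.
by rewrite (bext_linear HX (bal_mulr c)) -!(cD_l HX) (cD_linear HX).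
Qed.

Lemma cDl_spans : spans (fun a b => cDl X b a).
Proof.
move=> t; have [s ->] := cDl_gen HX t.
exists (map (fun p => (p.1 *: p.2.1, p.2.2)) s); rewrite big_map.
by apply: eq_bigr => p _; rewrite (lin_scale (cDl_linr _)).
Qed.

Lemma cDl_mul a b c : cDl X (a · b) c = cD X a (cDl X b c).
Proof.
apply/esym/(cDl_unique HX) => d; rewrite (cD_mul HX) (cD_l HX b).
have cDr_comm t : cD X a (bext X (fun p q => pure X p (q · d)) t) =
    bext X (fun p q => pure X p (q · d)) (cD X a t).
  apply: (pure_ext HX (f := fun t => cD X a (bext X _ t))
    (g := fun t => bext X _ (cD X a t))).
  - exact/(lin_comp (cD_end HX a))/(bext_linear HX)/bal_mulr.
  - exact/(lin_comp (bext_linear HX (bal_mulr d)))/(cD_end HX).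
  move=> p q; rewrite (bext_pure HX (bal_mulr d)) !(cD_l HX).
  rewrite (bext_bext (G := fun p q => pure X p (q · d)) id _ _ (bal_mulr d)).
  by apply: eq_bext => p' q'; rewrite (mA_assoc HF).
by rewrite cDr_comm.
Qed.

Lemma cDl_mulr b a c :
  cDl X b (a · c) = bext X (fun p q => pure X (p · c) q) (cDl X b a).
Proof.
apply/esym/(cDl_unique HX) => d; rewrite (cD_r HX).
under eq_bext do rewrite (mA_assoc HF).
rewrite -(bext_bext (fun p => p · a) id _ (bal_mull c)) -(cD_r HX) (cD_l HX).
rewrite (bext_bext id _ _ (bal_mull c)).
by rewrite (bext_bext _ id _ (bal_mulr d)).
Qed.

(** The bimodule property of [Δ] only concerns elements [x y a x' y'], which span
    [A] because [B A = A B = C A = A C = A]. *)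
Lemma frame_ext (V : lmodType K) (f g : fA F -> V) : linear f -> linear g ->
  (forall x y x' y' a, f (lB x (lC y (rB x' (rC y' a)))) =
                       g (lB x (lC y (rB x' (rC y' a))))) -> f =1 g.
Proof.
move=> fL gL fg.
apply: (spans_ext (bm_lspan HB) fL gL) => x.
apply: (spans_ext (bm_lspan HC)
  (lin_comp fL (bm_lr HB x)) (lin_comp gL (bm_lr HB x))) => y.
apply: (spans_ext (bm_rspan HB)
  (lin_comp (lin_comp fL (bm_lr HB x)) (bm_lr HC y))
  (lin_comp (lin_comp gL (bm_lr HB x)) (bm_lr HC y))) => x'.
apply: (spans_ext (bm_rspan HC)
  (lin_comp (lin_comp (lin_comp fL (bm_lr HB x)) (bm_lr HC y)) (bm_rr HB x'))
  (lin_comp (lin_comp (lin_comp gL (bm_lr HB x)) (bm_lr HC y))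
    (bm_rr HB x'))) => y' a.
exact: fg.
Qed.

Lemma bal_lCB y x : balanced (fun p q => pure X (lC y p) (lB x q)).
Proof.
apply: balanced_pure; try by flin HF.
  by move=> x' a; rewrite (lBC HF).
by move=> y' a; rewrite (lBC HF).
Qed.

Lemma cD_lB x a t :
  cD X (lB x a) t = bext X (fun p q => pure X p (lB x q)) (cD X a t).
Proof.
move: a; apply: frame_ext => [||x0 y0 x' y' a].
- exact: (lin_comp (cD_linear HX t) (bm_lr HB x)).
- exact: (lin_comp (bext_linear HX (bal_lB x)) (cD_linear HX t)).
rewrite -(bm_lM HB) !(cD_bimod HX) (bext_bext _ _ _ (bal_lB x)).
by apply: eq_bext => p q; rewrite (bm_lM HB).
Qed.

Lemma cD_rC y a t :
  cD X (rC y a) t = cD X a (bext X (fun p q => pure X (lC y p) q) t).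
Proof.
move: a; apply: frame_ext => [||x0 y0 x' y' a].
- exact: (lin_comp (cD_linear HX t) (bm_rr HC y)).
- exact: (cD_linear HX).
rewrite -(lB_rC HF) -(lC_rC HF) -(rBC HF) -(bm_rM HC) !(cD_bimod HX).
rewrite (bext_bext _ id _ (bal_lCB y' x')).
by congr (bext X _ (cD X a _)); apply: eq_bext => p q; rewrite (bm_lM HC).
Qed.

Lemma cD_rB x a t :
  cD X (rB x a) t = cD X a (bext X (fun p q => pure X p (lB x q)) t).
Proof.
move: a; apply: frame_ext => [||x0 y0 x' y' a].
- exact: (lin_comp (cD_linear HX t) (bm_rr HB x)).
- exact: (cD_linear HX).
rewrite -(lB_rB HF) -(lC_rB HF) -(bm_rM HB) !(cD_bimod HX).
rewrite (bext_bext id _ _ (bal_lCB y' x')).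
by congr (bext X _ (cD X a _)); apply: eq_bext => p q; rewrite (bm_lM HB).
Qed.

(** [Δ(b y) = Δ(b)(y ⊗ 1)].  By uniqueness, each property of the operators [Δ(b)]
    becomes a rule for the elements [Δ(b)(a ⊗ 1)]. *)
Lemma cDl_rC y b a : cDl X (rC y b) a = cDl X b (lC y a).
Proof.
apply/esym/(cDl_unique HX) => c.
by rewrite cD_rC (bext_pure HX (bal_lC y)) (cD_l HX).
Qed.

Lemma cDl_lB x b a :
  cDl X (lB x b) a = bext X (fun p q => pure X p (lB x q)) (cDl X b a).
Proof.
apply/esym/(cDl_unique HX) => c.
rewrite cD_lB (cD_l HX).
rewrite (bext_bext (fun p => p) _ _ (bal_lB x)).
rewrite (bext_bext (fun p => p) _ _ (bal_mulr c)).
by apply: eq_bext => p q; rewrite (bm_lA HB).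
Qed.

Lemma cDl_rB x b a :
  cDl X (rB x b) a = bext X (fun p q => pure X p (rB x q)) (cDl X b a).
Proof.
apply/esym/(cDl_unique HX) => c.
rewrite cD_rB (bext_pure HX (bal_lB x)) (cD_l HX).
rewrite (bext_bext (fun p => p) _ _ (bal_mulr c)).
by apply: eq_bext => p q; rewrite (bm_mid HB).
Qed.

Lemma cDl_bal x b a :
  cDl X b (lB x a) = bext X (fun p q => pure X p (rC (sB x) q)) (cDl X b a).
Proof.
apply/esym/(cDl_unique HX) => c.
rewrite (bal_m (pure_bal HX)) (cD_l HX).
rewrite (bext_bext (fun p => p) _ _ (bal_mulr c)).
by apply: eq_bext => p q; rewrite (bm_mid HC).
Qed.

(** Slices in the second leg by a left [C]-linear map [g]. *)
Lemma balanced_slice (g : fA F -> fC F) : linear g ->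
  (forall y a, g (lC y a) = mC y (g a)) ->
  balanced (fun p q => lB (sBi (g q)) p).
Proof.
move=> gL gC; split=> [b|a|x a b]; first by flin HF.
  by move=> k u v; rewrite gL !(frame_lin HF).
have HsB := frame_sB HF.
by rewrite gC (anti_invM HsB) (antiK HsB) (bm_lM HB).
Qed.

End ComulTheory.

Lemma cDr_mul (K : fieldType) (F : frame K) (X : comul (fA F)) :
  frame_axioms F -> comul_axioms X ->
  forall a b c, cDr X (a · b) c = cD X a (cDr X b c).
Proof.
by move=> HF HX; apply: (cDl_mul (fco_axioms HF) (flip_axioms HF HX)).
Qed.

Lemma cDr_spans (K : fieldType) (F : frame K) (X : comul (fA F)) :
  frame_axioms F -> comul_axioms X -> spans (cDr X).
Proof.
move=> HF HX t.
have [s ->] := cDl_spans (fco_axioms HF) (flip_axioms HF HX) t.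
by exists (map (fun p => (p.2, p.1)) s); rewrite big_map.
Qed.

(** * Hopf data and their symmetries *)

Record counit_axioms (K : fieldType) (F : frame K) (X : comul (fA F))
    (e : fA F -> fB F) : Prop := CounitAxioms {
  e_lin : linear e;
  e_lB : forall x a, e (lB x a) = mB x (e a);
  e_lC : forall x a, e (lC (sB x) a) = mB (e a) x;
  e_counit1 : forall a b,
    bext X (fun p q => lC (sB (e p)) q) (cDr X a b) = a · b;
  e_counit2 : forall a b, bext X (fun p q => lB (e q) p) (cDl X b a) = b · a;
  e_mul : forall a b, e (a · b) = e (rB (e b) a);
  e_mulS : forall a b, e (a · b) = e (rC (sB (e b)) a) }.

(** The equality in [A ⊗_r A ⊗_l A] of [Δ_C ⊗ id] applied to [Δ_B(b)(1 ⊗ c)] and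
    of [id ⊗ Δ_B] applied to [(a ⊗ 1)Δ_C(b)], tested against all balanced
    trilinear maps.  On the opposite algebra it is the other compatibility
    condition, with [Δ_B] and [Δ_C] interchanged. *)
Definition mixed_coassoc (K : fieldType) (F : frame K) (X Y : comul (fA F)) :=
  forall (V : lmodType K) (G : fA F -> fA F -> fA F -> V),
    (forall w, @balanced K (fop F) V (fun u v => G u v w)) ->
    (forall u, @balanced K F V (G u)) ->
  forall a b c,
    bext X (fun p q => bext Y (fun u v => G u v q) (cDl Y p a)) (cDr X b c) =
    bext Y (fun u v => bext X (fun p q => G u p q) (cDr X v c)) (cDl Y b a).

(** [hX] is the left comultiplication, with counit [eX] into [B]; [hY] is the
    right one on the opposite algebra.  Its counit [eY] is also taken with values
    in [B], namely [S_C] after the right counit. *)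
Record hopf (K : fieldType) := Hopf {
  hF : frame K;
  hX : comul (fA hF);
  hY : comul (fA hF);
  eX : fA hF -> fB hF;
  eY : fA hF -> fB hF;
  muB : fB hF -> K;
  muC : fC hF -> K }.

Record hopf_axioms (K : fieldType) (P : hopf K) : Prop := HopfAxioms {
  h_frame : frame_axioms (hF P);
  h_X : comul_axioms (hX P);
  h_Y : @comul_axioms K (fop (hF P)) (hY P);
  h_rl : mixed_coassoc (hX P) (hY P);
  h_lr : @mixed_coassoc K (fop (hF P)) (hY P) (hX P);
  h_eX : counit_axioms (hX P) (@eX _ P);
  h_eY : @counit_axioms K (fop (hF P)) (hY P) (@eY _ P);
  muB_lin : scalar (@muB _ P);
  muC_lin : scalar (@muC _ P);
  muB_nondegl : forall z : fB (hF P), (forall x, muB (mB x z) = 0) -> z = 0;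
  muB_nondegr : forall z : fB (hF P), (forall x, muB (mB z x) = 0) -> z = 0;
  muC_nondegl : forall z : fC (hF P), (forall x, muC (mC x z) = 0) -> z = 0;
  muC_nondegr : forall z : fC (hF P), (forall x, muC (mC z x) = 0) -> z = 0;
  muC_sB : forall x : fB (hF P), muC (sB x) = muB x;
  muB_sC : forall y : fC (hF P), muB (sC y) = muC y;
  mu_e : forall a : fA (hF P), muB (eX a) = muB (eY a) }.

Section HopfSymmetries.
Variable K : fieldType.
Implicit Type P : hopf K.

Definition hop P : hopf K :=
  @Hopf K (fop (hF P)) (hY P) (hX P) (@eY _ P) (@eX _ P) (@muB _ P) (@muC _ P).

Definition hco P : hopf K :=
  @Hopf K (fco (hF P)) (flip (hX P)) (flip (hY P))
    (fun a => sB (eX a)) (fun a => sCi (eY a)) (@muC _ P) (@muB _ P).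

Lemma hop_axioms P : hopf_axioms P -> hopf_axioms (hop P).
Proof.
case=> HF HX HY Hrl Hlr HeX HeY mBl mCl Bl Br Cl Cr CsB BsC mue.
have [_ _ sBK sBiK _ _] := frame_sB HF; have [_ _ sCK sCiK _ _] := frame_sC HF.
split=> //=.
- exact: fop_axioms.
- by move=> x; rewrite -BsC sCiK.
- by move=> x; rewrite -CsB sBiK.
Qed.

Lemma counit_co (F : frame K) (X : comul (fA F)) (e : fA F -> fB F) :
  frame_axioms F -> counit_axioms X e ->
  @counit_axioms K (fco F) (flip X) (fun a => sB (e a)).
Proof.
move=> HF [el elB elC e1 e2 em emS].
have [sl sil sK siK sM siM] := frame_sB HF.
split=> //=.
- exact: (lin_comp sl).
- by move=> y a; rewrite -{1}[y]siK elC sM siK.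
- by move=> y a; rewrite elB sM siK.
- by move=> a b; rewrite -e2; congr bext; do 2!apply: funext=> ?; rewrite sK.
- by move=> a b; rewrite emS.
- by move=> a b; rewrite em sK.
Qed.

Lemma mixed_coassoc_co (F : frame K) (X Y : comul (fA F)) :
  frame_axioms F ->
  @mixed_coassoc K (fop F) Y X -> @mixed_coassoc K (fco F) (flip X) (flip Y).
Proof.
move=> HF H V G G1 G2 a b c /=.
have /= -> // := H V (fun u v w => G w v u) _ _ c b a.
- move=> w; apply: (balanced_flip HF); exact: G2.
- move=> u; apply: (balanced_flip (fop_axioms HF)).
  exact: (G1 u).
Qed.

Lemma hco_axioms P : hopf_axioms P -> hopf_axioms (hco P).
Proof.
case=> HF HX HY Hrl Hlr HeX HeY mBl mCl Bl Br Cl Cr CsB BsC mue.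
have [_ _ sBK sBiK _ _] := frame_sB HF; have [_ _ sCK sCiK _ _] := frame_sC HF.
have HFo := fop_axioms HF.
split=> //=.
- exact: fco_axioms.
- exact: flip_axioms.
- exact: (flip_axioms HFo HY).
- exact: mixed_coassoc_co.
- exact: (mixed_coassoc_co HFo).
- exact: counit_co.
- exact: (counit_co HFo HeY).
- by move=> y; rewrite -CsB sBiK.
- by move=> y; rewrite -BsC sCiK.
- by move=> a; rewrite CsB mue -BsC sCiK.
Qed.

End HopfSymmetries.

Section Integrals.
Variables (K : fieldType) (P : hopf K).
Local Notation F := (hF P).
Local Notation A := (fA F).

Record frame_adapted (w : A -> K) (Bw wB : A -> fB F) (Cw wC : A -> fC F) :
    Prop := FrameAdapted {
  fad_lin : scalar w;
  fad_Bl : forall x a, w (lB x a) = muB (mB x (Bw a));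
  fad_Br : forall x a, w (rB x a) = muB (mB (wB a) x);
  fad_Cl : forall y a, w (lC y a) = muC (mC y (Cw a));
  fad_Cr : forall y a, w (rC y a) = muC (mC (wC a) y) }.

(** Left invariance for [Δ_B] of a functional with [C]-valued version [Cw].  On
    the opposite algebra it is left invariance for [Δ_C]; after a flip of the
    legs it is right invariance, as [C] is then replaced by [B]. *)
Definition left_inv (Cw : A -> fC F) : Prop :=
  forall a b, bext (hX P) (fun p q => lB (sBi (Cw q)) p) (cDl (hX P) b a) =
              lC (Cw b) a.

End Integrals.

Section IntegralSymmetries.
Variables (K : fieldType) (P : hopf K).
Implicit Type w : fA (hF P) -> K.

Lemma adapted_op w Bw wB Cw wC : frame_adapted w Bw wB Cw wC ->
  @frame_adapted K (hop P) w wB Bw wC Cw.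
Proof. by case=> *; split. Qed.

Lemma adapted_co w Bw wB Cw wC : frame_adapted w Bw wB Cw wC ->
  @frame_adapted K (hco P) w Cw wC Bw wB.
Proof. by case=> *; split. Qed.

End IntegralSymmetries.

(** * Adapted functionals *)

Section AdaptedLeft.
Variables (K : fieldType) (P : hopf K).
Hypothesis HP : hopf_axioms P.
Local Notation F := (hF P).
Local Notation A := (fA F).

Let HF : frame_axioms F := h_frame HP.
Let HB := frameB HF.

Lemma muB_eql (z z' : fB F) :
  (forall x, muB (mB x z) = muB (mB x z')) -> z = z'.
Proof.
move=> zz'; apply/eqP; rewrite -subr_eq0; apply/eqP/(muB_nondegl HP) => x.
rewrite (lin_sub (bm_mulr HB x)).
by rewrite (@lin_sub K _ K^o _ (muB_lin HP)) zz' subrr.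
Qed.

Lemma muB_eqr (z z' : fB F) :
  (forall x, muB (mB z x) = muB (mB z' x)) -> z = z'.
Proof.
move=> zz'; apply/eqP; rewrite -subr_eq0; apply/eqP/(muB_nondegr HP) => x.
rewrite (lin_sub (bm_mull HB x)).
by rewrite (@lin_sub K _ K^o _ (muB_lin HP)) zz' subrr.
Qed.

Variables (w : A -> K) (Bw wB : A -> fB F) (Cw wC : A -> fC F).
Hypothesis Hw : frame_adapted w Bw wB Cw wC.

Lemma Bw_lin : linear Bw.
Proof.
move=> k a b; apply: muB_eql => x.
rewrite -(fad_Bl Hw) (bm_lr HB) (fad_lin Hw) (bm_mulr HB) (muB_lin HP).
by rewrite !(fad_Bl Hw).
Qed.

Lemma Bw_lB x a : Bw (lB x a) = mB x (Bw a).
Proof.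
apply: muB_eql => x'.
by rewrite -(fad_Bl Hw) -(bm_lM HB) (fad_Bl Hw) (mB_assoc HF).
Qed.

End AdaptedLeft.

Section Adapted.
Variables (K : fieldType) (P : hopf K).
Hypothesis HP : hopf_axioms P.
Local Notation F := (hF P).
Local Notation A := (fA F).

Let HF : frame_axioms F := h_frame HP.
Let HB := frameB HF.
Let HC := frameC HF.

Lemma muC_eql (z z' : fC F) :
  (forall x, muC (mC x z) = muC (mC x z')) -> z = z'.
Proof. exact: (muB_eql (hco_axioms HP)). Qed.

Lemma muC_eqr (z z' : fC F) :
  (forall x, muC (mC z x) = muC (mC z' x)) -> z = z'.
Proof. exact: (muB_eqr (hco_axioms HP)). Qed.

Variables (w : A -> K) (Bw wB : A -> fB F) (Cw wC : A -> fC F).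
Hypothesis Hw : frame_adapted w Bw wB Cw wC.

Lemma wB_lin : linear wB.
Proof. exact: (Bw_lin (hop_axioms HP) (adapted_op Hw)). Qed.

Lemma wB_rB x a : wB (rB x a) = mB (wB a) x.
Proof. exact: (Bw_lB (hop_axioms HP) (adapted_op Hw)). Qed.

Lemma Cw_lin : linear Cw.
Proof. exact: (Bw_lin (hco_axioms HP) (adapted_co Hw)). Qed.

Lemma Cw_lC y a : Cw (lC y a) = mC y (Cw a).
Proof. exact: (Bw_lB (hco_axioms HP) (adapted_co Hw)). Qed.

Lemma wC_lin : linear wC.
Proof.
exact: (Bw_lin (hop_axioms (hco_axioms HP)) (adapted_op (adapted_co Hw))).
Qed.

Hypothesis w_inv : left_inv Cw.

(** As [Δ(b y) = Δ(b)(y ⊗ 1)], left invariance makes [Cw] right linear. *)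
Lemma Cw_rC y b : Cw (rC y b) = mC (Cw b) y.
Proof.
apply: (lC_inj HF) => a; rewrite -w_inv (cDl_rC HF (h_X HP)) w_inv.
by rewrite (bm_lM HC).
Qed.

(** Both maps agree on [C A]: there [w (y' b y)] can be computed from either side
    because [Cw] is a bimodule map. *)
Lemma wC_eq : wC =1 Cw.
Proof.
apply: (spans_ext (bm_lspan HC) wC_lin Cw_lin) => y' b.
apply: muC_eqr => y.
rewrite -(fad_Cr Hw) -(lC_rC HF) (fad_Cl Hw) Cw_rC Cw_lC.
by rewrite (mC_assoc HF).
Qed.

Definition slice (t : tsq (hX P)) : A :=
  bext (hX P) (fun p q => lB (sBi (Cw q)) p) t.

Lemma bal_slice :
  @balanced K F (fA F) (fun p q => lB (sBi (Cw q)) p).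
Proof. apply: (balanced_slice HF); [exact: Cw_lin | exact: Cw_lC]. Qed.

Lemma slice_lin : linear slice.
Proof. exact: (bext_linear (h_X HP) bal_slice). Qed.

Lemma slice_pure p q : slice (pure (hX P) p q) = lB (sBi (Cw q)) p.
Proof. exact: (bext_pure (h_X HP) bal_slice). Qed.

End Adapted.

(** * The counit *)

Section Counit.
Variables (K : fieldType) (F : frame K) (X : comul (fA F)) (e : fA F -> fB F).
Hypotheses (HF : frame_axioms F) (HX : comul_axioms X).
Hypothesis He : counit_axioms X e.
Let HB := frameB HF.
Let HC := frameC HF.

Lemma bext0 (V : lmodType K) t : bext X (fun _ _ => 0 : V) t = 0.
Proof. by have [s ->] := bext_sum HX t; apply: big1 => p _; apply: scaler0. Qed.

Lemma cDr_rC y b c :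
  cDr X (rC y b) c = bext X (fun p q => pure X (rC y p) q) (cDr X b c).
Proof. exact: (cDl_rB (fco_axioms HF) (flip_axioms HF HX)). Qed.

Lemma bal_counitl : balanced (fun p q : fA F => lC (sB (e p)) q).
Proof.
split=> [b|a|x a b]; last 1 first.
- by rewrite (e_lB He) (antiM (frame_sB HF)) (bm_lM HC).
- by move=> k u v; rewrite (e_lin He) !(frame_lin HF).
- by flin HF.
Qed.

(** After right multiplication of the second leg by [c], the left side becomes the
    counit applied to the first leg of [Δ(b)(a ⊗ c)]; there [e (p a)] is
    [e (p S_B(e a))], and the counit property applies to [b S_B(e a)]. *)
Lemma counit_cDl b a :
  bext X (fun p q => lC (sB (e p)) q) (cDl X b a) = rC (sB (e a)) b.
Proof.
apply: (mA_cancell HF) => c; rewrite -[RHS](e_counit1 He) cDr_rC.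
rewrite (bext_bext HX _ (fun q => q) _ bal_counitl).
under [RHS]eq_bext do rewrite -(e_mulS He).
rewrite -(bext_bext HX (fun p => p · a) (fun q => q) _ bal_counitl).
rewrite -(cD_r HX) (cD_l HX) (bext_bext HX (fun p => p) _ _ bal_counitl).
rewrite (bext_lin HX _ _ (mAl HF c)); apply: eq_bext => p q.
by rewrite (bm_lA HC).
Qed.

Section Ideals.
Variables (V : lmodType K) (L : fA F -> V).
Hypothesis LL : linear L.

(** [e(A) A ⊆ A A], stated by linear maps that vanish on products: by counitality
    [e(q) p] is a sum of products once [p ⊗ q] is written with the elements
    [Δ(b)(a ⊗ 1)]. *)
Lemma vanish_counitB :
  (forall a b, L (a · b) = 0) -> forall p q, L (lB (e q) p) = 0.
Proof.
move=> L0 p q.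
have balG : balanced (fun p q : fA F => lB (e q) p).
  split=> [b|a|x a b]; first by flin HF.
    by move=> k u v; rewrite (e_lin He) !(frame_lin HF).
  by rewrite (e_lC He) (bm_lM HB).
rewrite -(bext_pure HX balG).
apply: (spans_vanish (cDl_spans HF HX) (lin_comp LL (bext_linear HX balG))).
by move=> a b; rewrite (e_counit2 He).
Qed.

(** [A A ⊆ A S_B(e(A))]. *)
Lemma vanish_mul_rC :
  (forall a b, L (rC (sB (e a)) b) = 0) -> forall a b, L (a · b) = 0.
Proof.
move=> L0 a b; rewrite -(e_counit1 He).
apply: (spans_vanish (cDl_spans HF HX)
  (lin_comp LL (bext_linear HX bal_counitl))).
by move=> a' b'; rewrite counit_cDl.
Qed.

(** [A A ⊆ e(A) A]. *)
Lemma vanish_mul_lB :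
  (forall p q, L (lB (e q) p) = 0) -> forall a b, L (a · b) = 0.
Proof.
move=> L0 a b; rewrite -(e_counit2 He) (bext_lin HX _ _ LL).
by rewrite -[RHS](bext0 V (cDl X a b)); apply: eq_bext.
Qed.

End Ideals.

(** Right multiplication by [z] vanishes on [A S_B(e(A))], hence on all
    products. *)
Lemma counit_essC (z : fC F) : (forall a, mC (sB (e a)) z = 0) -> z = 0.
Proof.
move=> z0; apply: (bm_rinj HC) => b; apply: (mA_nondegr HF) => a.
rewrite -(bm_rA HC).
apply: (vanish_mul_rC (bm_rr HC z)) => {a b} a b.
by rewrite -(bm_rM HC) z0; apply: (lin0 (bm_rl HC b)).
Qed.

End Counit.

Section CounitCo.
Variables (K : fieldType) (F : frame K) (X : comul (fA F)) (e : fA F -> fB F).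
Hypotheses (HF : frame_axioms F) (HX : comul_axioms X).
Hypothesis He : counit_axioms X e.

Lemma vanish_counitC (V : lmodType K) (L : fA F -> V) : linear L ->
  (forall a b, L (a · b) = 0) -> forall p q, L (lC (sB (e q)) p) = 0.
Proof.
exact: (vanish_counitB (fco_axioms HF) (flip_axioms HF HX) (counit_co HF He)).
Qed.

Lemma counit_essB (z : fB F) : (forall a, mB (e a) z = 0) -> z = 0.
Proof.
move=> z0.
apply: (counit_essC (fco_axioms HF) (flip_axioms HF HX) (counit_co HF He)).
by move=> a /=; rewrite (antiK (frame_sB HF)).
Qed.

End CounitCo.

(** * Comparing left and right integrals *)

Section ExchangeHalf.
Variables (K : fieldType) (P : hopf K).
Hypothesis HP : hopf_axioms P.
Local Notation F := (hF P).
Local Notation X := (hX P).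
Local Notation A := (fA F).
Let HF : frame_axioms F := h_frame HP.
Let HX := h_X HP.
Let HB := frameB HF.
Let HP' := hco_axioms HP.

Variables (w : A -> K) (Bw wB : A -> fB F) (Cw wC : A -> fC F).
Hypothesis Hw : frame_adapted w Bw wB Cw wC.
Variables (psi : A -> K) (Bpsi psiB : A -> fB F) (Cpsi psiC : A -> fC F).
Hypothesis Hpsi : frame_adapted psi Bpsi psiB Cpsi psiC.
Hypothesis psi_inv : @left_inv K (hco P) Bpsi.

(** Both sides are [mu_B (S_B^-1(Cw q) Bpsi(p))] at [p ⊗ q]. *)
Lemma slice_exchange t : w (@slice K (hco P) Bpsi t) = psi (slice Cw t).
Proof.
have HsB := frame_sB HF.
have sL : linear (slice Cw) := slice_lin HP Hw.
have sL' := slice_lin HP' (adapted_co Hpsi).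
apply: (@pure_ext K F X HX K^o (fun t => w (@slice K (hco P) Bpsi t))
  (fun t => psi (slice Cw t))).
- exact: (@lin_comp _ _ K^o _ (fad_lin Hw) _ _ sL').
- exact: (@lin_comp _ _ K^o _ (fad_lin Hpsi) _ _ sL).
move=> p q; rewrite (slice_pure HP Hw) (fad_Bl Hpsi) -(muC_sB HP).
rewrite (antiM HsB) (anti_invK HsB) -(fad_Cl Hw); congr w.
exact: (slice_pure HP' (adapted_co Hpsi)).
Qed.

(** Right invariance gives [w (Bpsi(x c) d)], and [Bpsi] is also the version of
    [psi] for right multiplication, so that [Bw(d)] can be moved inside. *)
Lemma slice_exchange_cDr x c d :
  w (@slice K (hco P) Bpsi (cD X x (cDr X c d))) = psi (x · rB (Bw d) c).
Proof.
rewrite -(cDr_mul HF HX) -(bm_rA HB) (fad_Br Hpsi).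
have -> : psiB (x · c) = Bpsi (x · c).
  exact: (wC_eq HP' (adapted_co Hpsi) psi_inv).
by rewrite -(fad_Bl Hw); congr w; apply: psi_inv.
Qed.

End ExchangeHalf.

Section Exchange.
Variables (K : fieldType) (P : hopf K).
Hypothesis HP : hopf_axioms P.
Local Notation F := (hF P).
Local Notation X := (hX P).
Local Notation A := (fA F).
Let HF : frame_axioms F := h_frame HP.
Let HX := h_X HP.
Let HB := frameB HF.
Let HC := frameC HF.
Let HP' := hco_axioms HP.

Variables (w : A -> K) (Bw wB : A -> fB F) (Cw wC : A -> fC F).
Hypothesis Hw : frame_adapted w Bw wB Cw wC.
Hypothesis w_inv : left_inv Cw.
Variables (psi : A -> K) (Bpsi psiB : A -> fB F) (Cpsi psiC : A -> fC F).
Hypothesis Hpsi : frame_adapted psi Bpsi psiB Cpsi psiC.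
Hypothesis psi_inv : @left_inv K (hco P) Bpsi.

Lemma slice_exchange_cDl x e f :
  psi (slice Cw (cD X x (cDl X e f))) = w (x · rC (Cpsi f) e).
Proof.
exact: (slice_exchange_cDr HP' (adapted_co Hpsi) (adapted_co Hw) w_inv).
Qed.

(** [A = A C] and [C = Cpsi(A)], so [e] may be taken of the form [e Cpsi(f)]; then
    [c] is read off an expression of [Δ(e)(f ⊗ 1)] by elements
    [Δ(c_i)(1 ⊗ d_i)]. *)
Lemma left_to_right : (forall y, exists f, Cpsi f = y) ->
  forall e, exists c, forall x, w (x · e) = psi (x · c).
Proof.
move=> Cpsi_surj.
apply: (spans_ind (bm_rspan HC)).
- exists 0 => x; rewrite (lin0 (mAr HF x)).
  by rewrite (@lin0 _ _ K^o _ (fad_lin Hw)) (@lin0 _ _ K^o _ (fad_lin Hpsi)).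
- move=> u v [c Hc] [d Hd]; exists (c + d) => x; rewrite !(lin_add (mAr HF x)).
  rewrite (@lin_add _ _ K^o _ (fad_lin Hw)) (@lin_add _ _ K^o _ (fad_lin Hpsi)).
  by rewrite Hc Hd.
move=> y e; have [f <-] := Cpsi_surj y.
suff [c Hc] : exists c, forall x, psi (slice Cw (cD X x (cDl X e f))) =
    psi (x · c).
  by exists c => x; rewrite -slice_exchange_cDl.
have psiL x : @GRing.linear_for K (tsq X) K^o *%R
    (fun t => psi (slice Cw (cD X x t))).
  move=> k u v; rewrite (cD_end HX) (slice_lin HP Hw).
  by rewrite (fad_lin Hpsi).
move: (cDl X e f); apply: (spans_ind (cDr_spans HF HX)).
- exists 0 => x; rewrite (@lin0 _ _ K^o _ (psiL x)) (lin0 (mAr HF x)).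
  by rewrite (@lin0 _ _ K^o _ (fad_lin Hpsi)).
- move=> u v [c Hc] [d Hd]; exists (c + d) => x.
  rewrite (@lin_add _ _ K^o _ (psiL x)) (lin_add (mAr HF x)).
  by rewrite (@lin_add _ _ K^o _ (fad_lin Hpsi)) Hc Hd.
move=> c d; exists (rB (Bw d) c) => x.
rewrite -(slice_exchange_cDr HP Hw Hpsi psi_inv).
by rewrite (slice_exchange HP Hw Hpsi).
Qed.

End Exchange.

Section Comparison.
Variables (K : fieldType) (P : hopf K).
Hypothesis HP : hopf_axioms P.
Local Notation F := (hF P).
Local Notation X := (hX P).
Local Notation A := (fA F).
Let HF : frame_axioms F := h_frame HP.
Let HX := h_X HP.
Let HB := frameB HF.
Let HC := frameC HF.
Let HP' := hco_axioms HP.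

Variables (phi : A -> K) (Bphi phiB : A -> fB F) (Cphi phiC : A -> fC F).
Hypothesis Hphi : frame_adapted phi Bphi phiB Cphi phiC.
Hypothesis phi_inv : left_inv Cphi.
Variables (psi : A -> K) (Bpsi psiB : A -> fB F) (Cpsi psiC : A -> fC F).
Hypothesis Hpsi : frame_adapted psi Bpsi psiB Cpsi psiC.
Hypothesis psi_inv : @left_inv K (hco P) Bpsi.

Lemma right_to_left : (forall x, exists a, Bphi a = x) ->
  forall c, exists e, forall x, psi (x · c) = phi (x · e).
Proof.
exact: (left_to_right HP' (adapted_co Hpsi) psi_inv (adapted_co Hphi)
  phi_inv).
Qed.

Hypothesis psi_faithful : forall z, (forall x, psi (x · z) = 0) -> z = 0.

(** Let [phi (x e) = psi (x (k e))].  The functional [phi - psi k] vanishes on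
    products, hence on [b e] for [b] in the image of the counit; as this image is
    an ideal of [B] without annihilator, [Bphi e = Bpsi (k e)]. *)
Lemma right_surjective :
  (forall y, exists f, Cpsi f = y) -> (forall x, exists a, Bphi a = x) ->
  forall x, exists a, Bpsi a = x.
Proof.
move=> Cpsi_surj Bphi_surj b0; have [e <-] := Bphi_surj b0.
have /choice [k Hk] := left_to_right HP Hphi phi_inv Hpsi psi_inv Cpsi_surj.
have psi_inj u v : (forall x, psi (x · u) = psi (x · v)) -> u = v.
  move=> uv; apply/eqP; rewrite -subr_eq0; apply/eqP/psi_faithful => x.
  rewrite (lin_sub (mAr HF x)) (@lin_sub _ _ K^o _ (fad_lin Hpsi)) uv.
  exact: subrr.
have kL : linear k.
  move=> l u v; apply: psi_inj => x; rewrite -Hk !(mAr HF).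
  by rewrite (fad_lin Hphi) (fad_lin Hpsi) !Hk.
have kM a u : k (a · u) = a · k u.
  by apply: psi_inj => x; rewrite -Hk !(mA_assoc HF).
have chiB b u : k (lB b u) = lB b (k u).
  by apply: psi_inj => x; rewrite -Hk -!(bm_mid HB) Hk.
pose L u : K^o := phi u - psi (k u).
have LL : linear L.
  move=> l u v; rewrite /L kL (fad_lin Hphi) (fad_lin Hpsi) /=.
  by rewrite opprD addrACA scalerBr.
have L0 a b : L (a · b) = 0 by rewrite /L kM Hk subrr.
exists (k e); apply/esym/eqP; rewrite -subr_eq0; apply/eqP.
apply: (counit_essB HF HX (h_eX HP)) => a.
apply: (muB_nondegl HP) => x.
rewrite (mB_assoc HF) -(e_lB (h_eX HP)); set b := eX _.
have := vanish_counitB HF HX (h_eX HP) LL L0 e (lB x a).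
rewrite /L chiB (fad_Bl Hphi) (fad_Bl Hpsi) -/b.
by rewrite (lin_sub (bm_mulr HB b)) (@lin_sub _ _ K^o _ (muB_lin HP)).
Qed.

Variables (w : A -> K) (Bw wB : A -> fB F) (Cw wC : A -> fC F).
Hypothesis Hw : frame_adapted w Bw wB Cw wC.
Hypothesis w_inv : left_inv Cw.

Lemma left_to_left :
  (forall y, exists f, Cpsi f = y) -> (forall x, exists a, Bphi a = x) ->
  forall e, exists e', forall x, w (x · e) = phi (x · e').
Proof.
move=> Cpsi_surj Bphi_surj e.
have [c Hc] := left_to_right HP Hw w_inv Hpsi psi_inv Cpsi_surj e.
have [e' He'] := right_to_left Bphi_surj c.
by exists e' => x; rewrite Hc.
Qed.

(** Write [p ⊗ x = sum Δ(x_i)(p_i ⊗ 1)].  By left invariance the slice of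
    [Δ(e)(p ⊗ x) = sum Δ(e x_i)(p_i ⊗ 1)] by [w] only involves the values
    [w (e x_i)]. *)
Lemma slice_cDr_transfer e e' : (forall x, w (e · x) = phi (e' · x)) ->
  forall x, slice Cw (cDr X e x) = slice Cphi (cDr X e' x).
Proof.
move=> ee' x.
have Cee' u : Cw (e · u) = Cphi (e' · u).
  rewrite -(wC_eq HP Hw w_inv) -(wC_eq HP Hphi phi_inv).
  apply: (muC_eqr HP) => y; rewrite -(fad_Cr Hw) -(fad_Cr Hphi).
  by rewrite !(bm_rA HC).
have sE t : slice Cw (cD X e t) = slice Cphi (cD X e' t).
  apply: (spans_ext (cDl_spans HF HX) (f := fun t => slice Cw (cD X e t))
    (g := fun t => slice Cphi (cD X e' t))) => [||u p].
  - exact/(lin_comp (slice_lin HP Hw))/(cD_end HX).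
  - exact/(lin_comp (slice_lin HP Hphi))/(cD_end HX).
  rewrite -!(cDl_mul HF HX).
  transitivity (lC (Cw (e · p)) u); first exact: w_inv.
  by rewrite Cee'; apply/esym/phi_inv.
apply: (mA_cancell HF) => p.
have key (g : A -> fC F) f : balanced (fun p q => lB (sBi (g q)) p) ->
    slice g (cDr X f x) · p = slice g (cD X f (pure X p x)).
  move=> balg; rewrite (cD_r HX) /slice (bext_bext HX _ (fun q => q) _ balg).
  rewrite (bext_lin HX _ _ (mAl HF p)).
  by apply: eq_bext => p' q'; rewrite (bm_lA HB).
rewrite (key _ _ (bal_slice HP Hw)) sE.
by rewrite (key _ _ (bal_slice HP Hphi)).
Qed.

Lemma left_transfer e e' : (forall x, w (e · x) = phi (e' · x)) ->
  forall x, w (lB (Bpsi e) x) = phi (lB (Bpsi e') x).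
Proof.
move=> ee' x.
have -> : lB (Bpsi e) x = @slice K (hco P) Bpsi (cDr X e x).
  by apply/esym; apply: psi_inv.
have -> : lB (Bpsi e') x = @slice K (hco P) Bpsi (cDr X e' x).
  by apply/esym; apply: psi_inv.
rewrite (slice_exchange HP Hw Hpsi) (slice_exchange HP Hphi Hpsi).
by rewrite (slice_cDr_transfer ee').
Qed.

End Comparison.

(** * Invariance under the second comultiplication *)

Section SecondComul.
Variables (K : fieldType) (F : frame K) (Y : comul (fA F)).
Hypotheses (HF : frame_axioms F) (HY : @comul_axioms K (fop F) Y).
Let HFo := fop_axioms HF.

Lemma cDlY_lC y b a : cDl Y (lC y b) a = cDl Y b (rC y a).
Proof. exact: (cDl_rC HFo HY). Qed.

Lemma cDlY_lB x b a :
  cDl Y (lB x b) a = bext Y (fun p q => pure Y p (lB x q)) (cDl Y b a).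
Proof. exact: (cDl_rB HFo HY). Qed.

Lemma cDlY_bal x b a :
  cDl Y b (rB x a) =
  bext Y (fun p q => pure Y p (lC (sCi x) q)) (cDl Y b a).
Proof. exact: (cDl_bal HFo HY). Qed.

Lemma cDlY_mul b a c : cDl Y (b · a) c = cD Y a (cDl Y b c).
Proof. exact: (cDl_mul HFo HY). Qed.

Lemma cDY_l a b c :
  cD Y a (pure Y b c) = bext Y (fun p q => pure Y p (c · q)) (cDl Y a b).
Proof. exact: (cD_l HY). Qed.

Lemma cDY_r a b c :
  cD Y a (pure Y b c) = bext Y (fun p q => pure Y (b · p) q) (cDr Y a c).
Proof. exact: (cD_r HY). Qed.

End SecondComul.

Section Invariance.
Variables (K : fieldType) (P : hopf K).
Hypothesis HP : hopf_axioms P.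
Local Notation F := (hF P).
Local Notation X := (hX P).
Local Notation Y := (hY P).
Local Notation A := (fA F).
Let HF : frame_axioms F := h_frame HP.
Let HX := h_X HP.
Let HY := h_Y HP.
Let HB := frameB HF.
Let HC := frameC HF.
Let HFo := fop_axioms HF.

Variables (chi : A -> K) (Bchi chiB : A -> fB F) (Cchi chiC : A -> fC F).
Hypothesis Hchi : frame_adapted chi Bchi chiB Cchi chiC.
Hypothesis chi_faithful : forall z, (forall x, chi (z · x) = 0) -> z = 0.

(** The slice by [chi] in the first leg, for the tensor square of [Δ_C]. *)
Definition rslice (t : tsq Y) : A :=
  bext Y (fun r s => rC (sCi (chiB r)) s) t.

(** [conv u p = sum chi(u p_(1)) p_(2)], for [Δ_C]. *)
Definition conv (u p : A) : A := rslice (cDl Y p u).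

Lemma bal_rslice :
  @balanced K (fop F) A (fun r s : A => rC (sCi (chiB r)) s).
Proof.
split=> [b k u v|a|x a b]; last 1 first.
- rewrite /= (wB_rB HP Hchi) (anti_invM (frame_sC HF)).
  by rewrite (bm_rM HC).
- by rewrite (wB_lin HP Hchi) !(frame_lin HF).
- by move=> k u v; rewrite !(frame_lin HF).
Qed.

Lemma rslice_lin : linear rslice.
Proof. exact: (bext_linear HY bal_rslice). Qed.

Lemma conv_linl p : linear (conv^~ p).
Proof. exact/(lin_comp rslice_lin)/(cDl_linr HFo HY). Qed.

Lemma conv_linr u : linear (conv u).
Proof.
exact: (lin_comp (f := rslice) (g := (cDl Y)^~ u) rslice_lin
  (cDl_linl HFo HY u)).
Qed.

Lemma conv_lB u x p : conv u (lB x p) = lB x (conv u p).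
Proof.
rewrite /conv cDlY_lB // /rslice (bext_bext HY id _ _ bal_rslice).
rewrite (bext_lin HY _ _ (bm_lr HB x)); apply: eq_bext => r s.
by rewrite (lB_rC HF).
Qed.

Lemma conv_rB u x p : conv (rB x u) p = lC (sCi x) (conv u p).
Proof.
rewrite /conv cDlY_bal // /rslice (bext_bext HY id _ _ bal_rslice).
rewrite (bext_lin HY _ _ (bm_lr HC _)); apply: eq_bext => r s.
by rewrite (lC_rC HF).
Qed.

Lemma conv_lC u y p : conv u (lC y p) = conv (rC y u) p.
Proof. by rewrite /conv cDlY_lC. Qed.

Lemma rslice_cD p u v : rslice (cD Y p (pure Y u v)) = v · conv u p.
Proof.
rewrite cDY_l // /conv /rslice (bext_bext HY id _ _ bal_rslice).
rewrite (bext_lin HY _ _ (mAr HF v)); apply: eq_bext => r s.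
by rewrite (bm_rA HC).
Qed.

Lemma rslice_cDE p t : rslice (cD Y p t) = bext Y (fun u v => v · conv u p) t.
Proof.
rewrite -(bext_pureE HY t (L := fun t => rslice (cD Y p t))).
  by apply: eq_bext => u v; rewrite rslice_cD.
exact/(lin_comp rslice_lin)/(cD_end HY).
Qed.

(** [conv a (b p) = sum b_(2) (conv (a b_(1)) p)], as [Δ_C] is multiplicative. *)
Lemma conv_mul a b p :
  conv a (b · p) = bext Y (fun u v => v · conv u p) (cDl Y b a).
Proof. by rewrite /conv cDlY_mul // rslice_cDE. Qed.

Lemma bal_conv p : @balanced K (fop F) A (fun u v : A => v · conv u p).
Proof.
split=> [b k u v|a k u v|x a b].
- by rewrite conv_linl (mAr HF).
- by rewrite (mAl HF).
by rewrite /= conv_rB (bm_mid HC).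
Qed.

(** If [conv z = 0], then slicing [(z ⊗ v)Δ_C(p)] by [chi] gives zero.  These
    elements include [z r ⊗ s] for all [r] and [s], as the canonical maps are onto,
    so [chi (z r) = 0] for all [r]. *)
Lemma conv_inj z : (forall p, conv z p = 0) -> z = 0.
Proof.
move=> z0; apply: chi_faithful.
have chi0 r x : chi (z · rB x r) = 0.
  rewrite -(bm_rA HB) (fad_Br Hchi).
  suff -> : chiB (z · r) = 0.
    rewrite (lin0 (bm_mull HB x)).
    by rewrite (@lin0 _ _ K^o _ (muB_lin HP)).
  rewrite -(anti_invK (frame_sC HF) (chiB _)) -(lin0 (anti_lin (frame_sC HF))).
  congr (sC _); apply: (bm_rinj HC) => s.
  have zbal : @balanced K (fop F) A
      (fun r s : A => rC (sCi (chiB (z · r))) s).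
    split=> [b k u v|a k u v|x' a b].
    - by rewrite (mAr HF) (wB_lin HP Hchi) !(frame_lin HF).
    - by rewrite (frame_lin HF).
    rewrite /= -(bm_rA HB) (wB_rB HP Hchi) (anti_invM (frame_sC HF)).
    by rewrite (bm_rM HC).
  rewrite -(bext_pure HY zbal r s).
  apply: (spans_vanish (cDr_spans HFo HY) (bext_linear HY zbal)) => p v.
  transitivity (rslice (cD Y p (pure Y z v))).
    by rewrite cDY_r // /rslice (bext_bext HY _ id _ bal_rslice).
  by rewrite rslice_cD z0 (lin0 (mAr HF v)).
have LL : @GRing.linear_for K A K^o *%R (fun r => chi (z · r)).
  by move=> k u v; rewrite (mAr HF) (fad_lin Hchi).
exact: (spans_vanish (V := K^o) (bm_rspan HB) LL).
Qed.

(** [(conv u ⊗ id)(Δ_B(x)(p ⊗ 1)) = sum Δ_B(x_(2))(conv (u x_(1)) p ⊗ 1)], where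
    the right side uses [(u ⊗ 1)Δ_C(x)].  After multiplication by [1 ⊗ c] this is
    the mixed coassociativity for [x]; [tsq_cancelr] removes [c]. *)
Lemma conv_cDl u x p :
  bext X (fun r s => pure X (conv u r) s) (cDl X x p) =
  bext Y (fun u' v' => cDl X v' (conv u' p)) (cDl Y x u).
Proof.
have balu (u' : A) : balanced (fun r s => pure X (conv u' r) s).
  apply: (balanced_pure HX (f := conv u') (g := id)) => //;
    first exact: conv_linr.
  by move=> x' a; rewrite conv_lB.
apply: (tsq_cancelr HF HX) => c.
rewrite (bext_lin HY _ _ (bext_linear HX (bal_mulr HF HX c))).
under [RHS]eq_bext do rewrite -(cD_l HX) (cD_r HX).
rewrite (bext_bext HX (conv u) id _ (bal_mulr HF HX c)).
rewrite -(bext_bext HX id (fun s => s · c) _ (balu u)) -(cD_l HX) (cD_r HX).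
rewrite (bext_bext HX _ id _ (balu u)).
under eq_bext => r s.
  rewrite conv_mul.
  rewrite (bext_lin HY (fun u v : A => v · conv u p) _ (bal_l (pure_bal HX) s)).
  over.
apply: (h_rl HP (G := fun u v w => pure X (v · conv u p) w)).
- move=> w'; split=> [b k u' v|a k u' v|x' a b] /=.
  + by rewrite conv_linl (mAr HF) (bal_l (pure_bal HX)).
  + by rewrite (mAl HF) (bal_l (pure_bal HX)).
  + by rewrite conv_rB (bm_mid HC).
- move=> u'; split=> [b k u'' v|a k u'' v|x' a b] /=.
  + by rewrite (mAl HF) (bal_l (pure_bal HX)).
  + by rewrite (bal_r (pure_bal HX)).
  + by rewrite -(bm_lA HB) (bal_m (pure_bal HX)).
Qed.

Variables (phi : A -> K) (Bphi phiB : A -> fB F) (Cphi phiC : A -> fC F).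
Hypothesis Hphi : frame_adapted phi Bphi phiB Cphi phiC.
Hypothesis phi_inv : left_inv Cphi.

(** Slicing the last leg of the mixed coassociativity by [phi]: the operator
    [G b = sum phi(b_(2) c) b_(1)], formed with [Δ_B], satisfies
    [Δ_C(G b) = (id ⊗ G)(Δ_C(b))]. *)
Lemma cDlY_slice b a c : cDl Y (slice Cphi (cDr X b c)) a =
  bext Y (fun u v => pure Y u (slice Cphi (cDr X v c))) (cDl Y b a).
Proof.
have pr := bal_r (pure_bal HY).
have bal1 w : @balanced K (fop F) (tsq Y)
    (fun u v : A => pure Y u (lB (sBi (Cphi w)) v)).
  apply: (@balanced_pure K (fop F) Y HY id) => //; first exact: (bm_lr HB).
  by move=> y s; rewrite /= (lB_rC HF).
have bal2 u : @balanced K F (tsq Y)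
    (fun v w : A => pure Y u (lB (sBi (Cphi w)) v)).
  exact: (balanced_comp (pr u) (bal_slice HP Hphi)).
have := h_rl HP bal1 bal2 a b c.
under eq_bext do rewrite -cDlY_lB //.
rewrite -(bext_lin HX _ _ (cDl_linl HFo HY a)) => ->.
by apply: eq_bext => u v; rewrite -(bext_lin HX _ _ (pr u)).
Qed.

Lemma slice_cD b r s :
  slice Cphi (cD X b (pure X r s)) = slice Cphi (cDr X b s) · r.
Proof.
rewrite (cD_r HX) /slice (bext_bext HX _ id _ (bal_slice HP Hphi)).
rewrite (bext_lin HX _ _ (mAl HF r)); apply: eq_bext => p q.
by rewrite (bm_lA HB).
Qed.

Let oslice := @slice K (hop P) phiC.
Let HPo := hop_axioms HP.
Let oslice_lin : linear oslice := slice_lin HPo (adapted_op Hphi).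

(** Compare [conv (_) p] of both sides.  On the right this is [conv a] of
    [Cphi (b x) p], which by invariance for [Δ_B] is a slice of
    [Δ_B(b) Δ_B(x)(p ⊗ 1)].  Both [Δ_B(b)] and [Δ_B(x)] are then exchanged with
    [conv] by [cDlY_slice] and [conv_cDl]; invariance for [Δ_B], applied to the
    products [v v'] of second legs in [(a ⊗ 1)Δ_C(b)Δ_C(x)], gives the left
    side. *)
Lemma left_inv_op_mul a b x :
  oslice (cDl Y (b · x) a) = rC (phiC (b · x)) a.
Proof.
have phiCE := wC_eq HP Hphi phi_inv.
apply/eqP; rewrite -subr_eq0; apply/eqP/conv_inj => p.
rewrite (lin_sub (conv_linl p)); apply/eqP; rewrite subr_eq0; apply/eqP/esym.
have sL v : linear (fun t => slice Cphi (cD X v t)).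
  exact/(lin_comp (slice_lin HP Hphi))/(cD_end HX).
rewrite phiCE -conv_lC -phi_inv -/(slice _ _) (cDl_mul HF HX).
rewrite -(bext_pureE HX _ (sL b)) (bext_lin HX _ _ (conv_linr a)).
transitivity (bext Y (fun u v : A =>
    bext X (fun r s => slice Cphi (cDr X v s) · conv u r) (cDl X x p))
    (cDl Y b a)).
  rewrite -(bext_exchange HX (F' := fop F) (X' := Y) _ _ _ HY).
  apply: eq_bext => r s; rewrite slice_cD conv_mul cDlY_slice.
  exact: (bext_bext HY id (fun v => slice Cphi (cDr X v s)) _ (bal_conv r)).
have oL : linear (fun t => conv (oslice (cD Y x t)) p).
  exact/(lin_comp (conv_linl p))/(lin_comp oslice_lin)/(cD_end HY).
rewrite cDlY_mul // -(bext_pureE HY _ oL); apply: eq_bext => u v.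
transitivity (slice Cphi
    (cD X v (bext X (fun r s => pure X (conv u r) s) (cDl X x p)))).
  rewrite (bext_lin HX _ _ (sL v)); apply: eq_bext => r s.
  by rewrite slice_cD.
rewrite conv_cDl (bext_lin HY _ _ (sL v)) cDY_l // /oslice /slice.
rewrite (bext_bext HY id _ _ (bal_slice HPo (adapted_op Hphi))).
rewrite (bext_lin HY _ _ (conv_linl p)); apply: eq_bext => u' v'.
rewrite -(cDl_mul HF HX) conv_rB (antiK (frame_sC HF)) phiCE.
exact: phi_inv.
Qed.

(** The defect [H a b] of invariance for [Δ_C] vanishes if [b] is a product, thus
    if [b] is in [S_B(eX(A)) A]; the factor in [S_B(eX(A))] can be moved to [a],
    and [A S_B(eX(A))] contains all products.  So [u (H a b) = H (u a) b = 0]. *)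
Lemma left_inv_op : @left_inv K (hop P) phiC.
Proof.
move=> a b.
have phiCE := wC_eq HP Hphi phi_inv.
pose H a b : A := oslice (cDl Y b a) - rC (phiC b) a.
have H_r a' : linear (H a').
  move=> k u v; rewrite /H (cDl_linl HFo HY) oslice_lin (wC_lin HP Hphi).
  by rewrite (bm_rl HC) opprD addrACA scalerBr.
have H_l b' : linear (H^~ b').
  move=> k u v; rewrite /H (cDl_linr HFo HY) oslice_lin.
  by rewrite (bm_rr HC) opprD addrACA scalerBr.
have H_mul a' u v : H a' (u · v) = 0 by rewrite /H left_inv_op_mul subrr.
have H_C y a' b' : H a' (lC y b') = H (rC y a') b'.
  by rewrite /H cDlY_lC // !phiCE (Cw_lC HP Hphi) (bm_rM HC).
have H_rC q a' b' : H (rC (sB (eX q)) a') b' = 0.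
  rewrite -H_C; apply: (vanish_counitC HF HX (h_eX HP) (H_r a')).
  exact: H_mul.
have H_lmul u v b' : H (u · v) b' = 0.
  apply: (vanish_mul_rC HF HX (h_eX HP) (H_l b')) => q a'.
  exact: H_rC.
have H_A u a' b' : H (u · a') b' = u · H a' b'.
  rewrite /H (lin_sub (mAr HF u)) (bm_rA HC); congr (_ - _).
  have -> : cDl Y b' (u · a') =
      bext Y (fun p q => pure Y (u · p) q) (cDl Y b' a').
    exact: (cDl_mulr HFo HY).
  rewrite /oslice /slice.
  rewrite (bext_bext HY _ id _ (bal_slice HPo (adapted_op Hphi))).
  rewrite (bext_lin HY _ _ (mAr HF u)); apply: eq_bext => p q.
  exact: (bm_rA HB).
apply/eqP; rewrite -subr_eq0; apply/eqP/(mA_nondegr HF) => u.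
by rewrite -[_ - _]/(H a b) -H_A H_lmul.
Qed.

End Invariance.

(** * The modular automorphism of the base weight *)

Section Modular.
Variables (K : fieldType) (P : hopf K).
Hypothesis HP : hopf_axioms P.
Local Notation F := (hF P).
Local Notation X := (hX P).
Local Notation Y := (hY P).
Local Notation A := (fA F).
Let HF : frame_axioms F := h_frame HP.
Let HX := h_X HP.
Let HY := h_Y HP.
Let HB := frameB HF.
Let HC := frameC HF.
Let HFo := fop_axioms HF.
Let HsB := frame_sB HF.
Let HsC := frame_sC HF.
Let HeX := h_eX HP.
Let HeY := h_eY HP.

Lemma eY_rB x (a : A) : eY (rB x a) = mB (eY a) x.
Proof. exact: (e_lB HeY). Qed.

Lemma eY_lC_image b (a : A) : eY (lC (sCi (eY b)) a) = eY (lB (eY b) a).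
Proof. by rewrite -[LHS](e_mulS HeY) -[RHS](e_mul HeY). Qed.

(** The two multiplicativity properties of the right counit give this for [y] in
    its image [J], hence on [J A], which contains all products. *)
Lemma eY_lC_mul y (u v : A) : eY (lC y (u · v)) = eY (lB (sC y) (u · v)).
Proof.
pose L (a : A) : fB F := eY (lC y a) - eY (lB (sC y) a).
have LL : linear L.
  move=> k a b; rewrite /L !(frame_lin HF) !(e_lin HeY).
  by rewrite opprD addrACA scalerBr.
apply/eqP; rewrite -subr_eq0; apply/eqP.
apply: (vanish_mul_rC HFo HY HeY LL) => a b /=.
rewrite /L -(bm_lM HC).
have -> : mC y (sCi (eY a)) = sCi (eY (rB (sC y) a)).
  by rewrite eY_rB (anti_invM HsC) (antiK HsC).
rewrite eY_lC_image eY_rB (bm_lM HB) -eY_lC_image.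
by rewrite -(lBC HF) subrr.
Qed.

Definition sigma (x : fB F) : fB F := sC (sB x).

(** [mu_B (eX(a) x) = mu_B (eX (S_B(x) a))].  As [mu_B eX = mu_B eY], the counit
    may be replaced by [eY], for which [S_B(x)] acts as [S_C(S_B(x))] on
    products. *)
Lemma muB_modular_mul (u v : A) x :
  muB (mB (eX (u · v)) x) = muB (mB (sigma x) (eX (u · v))).
Proof.
rewrite -(e_lC HeX) (mu_e HP) eY_lC_mul -(mu_e HP).
by rewrite (e_lB HeX).
Qed.

Lemma muB_modular_ideal c d u x (w := mB (mB (eX c) (eX d)) u) :
  muB (mB w x) = muB (mB (sigma x) w).
Proof.
pose L (a : A) : K^o := muB (mB (eX a) x) - muB (mB (sigma x) (eX a)).
have LL : linear L.
  move=> k a b; rewrite /L (e_lin HeX) !(frame_lin HF) !(muB_lin HP).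
  by rewrite opprD addrACA scalerBr.
have -> : w = eX (lB (eX c) (lC (sB u) d)).
  by rewrite (e_lB HeX) (e_lC HeX) (mB_assoc HF).
apply/eqP; rewrite -subr_eq0; apply/eqP.
apply: (vanish_counitB HF HX HeX LL) => a b.
by rewrite /L muB_modular_mul subrr.
Qed.

Variables (psi : A -> K) (Bpsi psiB : A -> fB F) (Cpsi psiC : A -> fC F).
Hypothesis Hpsi : frame_adapted psi Bpsi psiB Cpsi psiC.
Hypothesis psi_inv : @left_inv K (hco P) Bpsi.

(** Put [N a = a x - sigma(x) a].  By the modularity of [mu_B] on the square of the
    ideal [I = eX(A)], [psi (N a) = 0] on [I I A], which contains
    [S_B(I) S_B(I) A]; hence [y y' Cpsi(N a) = 0] for [y], [y'] in [S_B(I)], and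
    [Cpsi(N a) = 0] because [S_B(I)] has no annihilator. *)
Lemma right_modular x (a : A) : psi (rB x a) = psi (lB (sigma x) a).
Proof.
have psiBE : psiB =1 Bpsi := wC_eq (hco_axioms HP) (adapted_co Hpsi) psi_inv.
pose N (a : A) := rB x a - lB (sigma x) a.
have NL : linear N.
  by move=> k u v; rewrite /N !(frame_lin HF) opprD addrACA scalerBr.
pose L (a : A) : K^o := psi (N a).
have LL : linear L by exact: (lin_comp (V := K^o) (fad_lin Hpsi) NL).
have L_comp (f : A -> A) : linear f -> linear (fun a => L (f a)).
  exact: lin_comp.
have LBB c d u : L (lB (eX c) (lB (eX d) u)) = 0.
  rewrite /L /N (@lin_sub _ _ K^o _ (fad_lin Hpsi)).
  rewrite (fad_Br Hpsi) (fad_Bl Hpsi) psiBE -(bm_lM HB) (Bw_lB HP Hpsi).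
  by rewrite muB_modular_ideal subrr.
have LCB q c p : L (lC (sB (eX q)) (lB (eX c) p)) = 0.
  rewrite -(lBC HF).
  apply: (vanish_counitC HF HX HeX (L_comp _ (bm_lr HB _))).
  apply: (vanish_mul_lB HX HeX (L_comp _ (bm_lr HB _))) => p' q'.
  exact: LBB.
have LCC q c p : L (lC (sB (eX q)) (lC (sB (eX c)) p)) = 0.
  apply: (vanish_counitC HF HX HeX (L_comp _ (bm_lr HC _))).
  apply: (vanish_mul_lB HX HeX (L_comp _ (bm_lr HC _))) => p' q'.
  exact: LCB.
have LC y b : L (lC y b) = muC (mC y (Cpsi (N b))).
  rewrite /L -(fad_Cl Hpsi) /N (lin_sub (bm_lr HC y)).
  by rewrite -(lC_rB HF) (lBC HF).
have N0 b : Cpsi (N b) = 0.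
  apply: (counit_essC HF HX HeX) => c.
  apply: (counit_essC HF HX HeX) => q.
  apply: (muC_nondegl HP) => y.
  have -> : mC y (mC (sB (eX q)) (mC (sB (eX c)) (Cpsi (N b)))) =
      mC (mC (sB (eX (lC y q))) (sB (eX c))) (Cpsi (N b)).
    rewrite -{2}[y](anti_invK HsB) (e_lC HeX) (antiM HsB) (anti_invK HsB).
    by rewrite !(mC_assoc HF).
  by rewrite -LC (bm_lM HC) LCC.
apply/eqP; rewrite -subr_eq0; apply/eqP.
rewrite -(@lin_sub _ _ K^o _ (fad_lin Hpsi)) -/(N a) -/(L a).
apply: (spans_vanish (bm_lspan HC) LL) => y b.
rewrite LC N0 (lin0 (bm_mulr HC y)).
exact: (@lin0 _ _ K^o _ (muC_lin HP)).
Qed.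

Lemma muB_modular : (forall x, exists a, Bpsi a = x) ->
  forall w x, muB (mB w x) = muB (mB (sigma x) w).
Proof.
move=> Bpsi_surj w x; have [a <-] := Bpsi_surj w.
have psiBE : psiB =1 Bpsi := wC_eq (hco_axioms HP) (adapted_co Hpsi) psi_inv.
by rewrite -psiBE -(fad_Br Hpsi) right_modular (fad_Bl Hpsi) psiBE.
Qed.

End Modular.

(** * Left integrals as multiples of one of them *)

Definition nondeg_functional (K : fieldType) (F : frame K) (w : fA F -> K) :=
  (forall z, (forall x, w (z · x) = 0) -> z = 0) /\
  (forall z, (forall x, w (x · z) = 0) -> z = 0).

Definition surj (T U : Type) (f : T -> U) := forall u, exists t, f t = u.

(** The hypotheses on the two integrals, together with their base-valued versions,
    in a form that both symmetries preserve. *)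
Record full_pair (K : fieldType) (P : hopf K)
    (phi : fA (hF P) -> K) (Bphi phiB : fA (hF P) -> fB (hF P))
    (Cphi phiC : fA (hF P) -> fC (hF P))
    (psi : fA (hF P) -> K) (Bpsi psiB : fA (hF P) -> fB (hF P))
    (Cpsi psiC : fA (hF P) -> fC (hF P)) : Prop := FullPair {
  fp_phi : frame_adapted phi Bphi phiB Cphi phiC;
  fp_phi_inv : left_inv Cphi;
  fp_phi_nondeg : nondeg_functional phi;
  fp_Bphi : surj Bphi;
  fp_phiB : surj phiB;
  fp_psi : frame_adapted psi Bpsi psiB Cpsi psiC;
  fp_psi_inv : @left_inv K (hco P) Bpsi;
  fp_psi_nondeg : nondeg_functional psi;
  fp_Cpsi : surj Cpsi;
  fp_psiC : surj psiC }.

Definition frame_integral (K : fieldType) (P : hopf K) (w : fA (hF P) -> K) :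
    Prop :=
  exists Bw wB Cw wC, frame_adapted w Bw wB Cw wC /\ left_inv Cw.

Record double_multiplier (K : fieldType) (B : lmodType K) (m : B -> B -> B)
    (tl tr : B -> B) : Prop := DoubleMultiplier {
  dm_l : linear tl;
  dm_r : linear tr;
  dm_lA : forall x y, tl (m x y) = m (tl x) y;
  dm_rA : forall x y, tr (m x y) = m x (tr y);
  dm_mid : forall x y, m x (tl y) = m (tr x) y }.

Lemma double_multiplier_op (K : fieldType) (B : lmodType K) (m : B -> B -> B)
    tl tr :
  double_multiplier m tl tr -> double_multiplier (fun x y => m y x) tr tl.
Proof. by case=> *; split. Qed.

Section FullPairSymmetries.
Variables (K : fieldType) (P : hopf K).
Hypothesis HP : hopf_axioms P.
Variables (phi : fA (hF P) -> K) (Bphi phiB : fA (hF P) -> fB (hF P))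
  (Cphi phiC : fA (hF P) -> fC (hF P))
  (psi : fA (hF P) -> K) (Bpsi psiB : fA (hF P) -> fB (hF P))
  (Cpsi psiC : fA (hF P) -> fC (hF P)).
Hypothesis Hfp : full_pair phi Bphi phiB Cphi phiC psi Bpsi psiB Cpsi psiC.

Lemma full_pair_co :
  @full_pair K (hco P) psi Cpsi psiC Bpsi psiB phi Cphi phiC Bphi phiB.
Proof.
case: Hfp => phi_ad phi_inv phi_nd Bphi_s phiB_s.
move=> psi_ad psi_inv psi_nd Cpsi_s psiC_s.
by split=> //; apply: adapted_co.
Qed.

Lemma full_pair_op :
  @full_pair K (hop P) phi phiB Bphi phiC Cphi psi psiB Bpsi psiC Cpsi.
Proof.
case: Hfp => phi_ad phi_inv phi_nd Bphi_s phiB_s.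
move=> psi_ad psi_inv psi_nd Cpsi_s psiC_s.
split=> //.
- exact: adapted_op.
- exact: (left_inv_op HP phi_ad phi_nd.1 phi_ad phi_inv).
- by case: phi_nd.
- exact: adapted_op.
- exact: (left_inv_op (hco_axioms HP) (adapted_co phi_ad) phi_nd.1
    (adapted_co psi_ad) psi_inv).
- by case: psi_nd.
Qed.

Lemma frame_integral_op w :
  frame_integral (P := P) w -> frame_integral (P := hop P) w.
Proof.
case=> Bw [wB [Cw [wC [w_ad w_inv]]]]; exists wB, Bw, wC, Cw.
split; first exact: adapted_op.
exact: (left_inv_op HP (fp_phi Hfp) (fp_phi_nondeg Hfp).1 w_ad w_inv).
Qed.

End FullPairSymmetries.

Section Uniqueness.
Variables (K : fieldType) (P : hopf K).
Hypothesis HP : hopf_axioms P.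
Local Notation F := (hF P).
Local Notation A := (fA F).
Local Notation B := (fB F).
Let HF : frame_axioms F := h_frame HP.
Let HX := h_X HP.
Let HB := frameB HF.
Variables (phi : A -> K) (Bphi phiB : A -> fB F) (Cphi phiC : A -> fC F)
  (psi : A -> K) (Bpsi psiB : A -> fB F) (Cpsi psiC : A -> fC F).
Hypothesis Hfp : full_pair phi Bphi phiB Cphi phiC psi Bpsi psiB Cpsi psiC.

Let phi_ad := fp_phi Hfp.

Lemma full_modular (u x : B) : muB (mB u x) = muB (mB (sigma x) u).
Proof.
apply: (muB_modular HP (fp_psi Hfp) (fp_psi_inv Hfp)).
exact: (right_surjective HP phi_ad (fp_phi_inv Hfp) (fp_psi Hfp)
  (fp_psi_inv Hfp) (fp_psi_nondeg Hfp).2 (fp_Cpsi Hfp) (fp_Bphi Hfp)).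
Qed.

(** The left half [tl] is obtained by comparing [w] and [phi] on [A] and applying
    [left_transfer]; the right half is [sigma(Bphi x) |-> sigma(Bw x)]. *)
Lemma left_integral_mult w : frame_integral w ->
  exists tl tr, double_multiplier (@mB K F) tl tr /\
    forall b x, w (lB b x) = phi (lB (tl b) x).
Proof.
move=> Hw; have [wB' [Bw' [wC' [Cw' [w_ado w_invo]]]]] :=
  frame_integral_op HP Hfp Hw.
case: Hw => Bw [wB [Cw [wC [w_ad w_inv]]]].
have Ho := full_pair_op HP Hfp.
have Bpsi_surj := right_surjective HP phi_ad (fp_phi_inv Hfp) (fp_psi Hfp)
  (fp_psi_inv Hfp) (fp_psi_nondeg Hfp).2 (fp_Cpsi Hfp) (fp_Bphi Hfp).
have phiB_inj b b' :
    (forall x, phi (lB b x) = phi (lB b' x)) -> b = b' :> B.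
  move=> bb'; apply: (muB_eqr HP) => u; have [x <-] := fp_Bphi Hfp u.
  by rewrite -!(fad_Bl phi_ad).
have /choice [tl Htl] (b : B) :
    exists b' : B, forall x, w (lB b x) = phi (lB b' x).
  have [e <-] := Bpsi_surj b.
  have [e' He'] := left_to_left (hop_axioms HP) (fp_phi Ho) (fp_phi_inv Ho)
    (fp_psi Ho) (fp_psi_inv Ho) w_ado w_invo (fp_Cpsi Ho) (fp_Bphi Ho) e.
  exists (Bpsi e').
  exact: (left_transfer HP phi_ad (fp_phi_inv Hfp) (fp_psi Hfp)
    (fp_psi_inv Hfp) w_ad w_inv He').
have tl_lin : linear tl.
  move=> k u v; apply: phiB_inj => x; rewrite -Htl !(bm_ll HB).
  by rewrite (fad_lin w_ad) (fad_lin phi_ad) !Htl.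
have tl_mul u v : tl (mB u v) = mB (tl u) v.
  by apply: phiB_inj => x; rewrite -Htl !(bm_lM HB) Htl.
have /choice [tr Htr] (v : B) : exists u : B, forall b, mB v (tl b) = mB u b.
  have [x Hx] := fp_Bphi Hfp (sBi (sCi v)).
  have -> : v = sigma (Bphi x).
    by rewrite Hx /sigma (anti_invK (frame_sB HF)) (anti_invK (frame_sC HF)).
  exists (sigma (Bw x)) => b; apply: (muB_eqr HP) => c.
  rewrite -!(mB_assoc HF) -tl_mul -!full_modular.
  by rewrite -(fad_Bl phi_ad) -(fad_Bl w_ad) Htl.
have B_cancel (z z' : B) : (forall b, mB z b = mB z' b) -> z = z'.
  by move=> zz'; apply: (muB_eqr HP) => x; rewrite zz'.
exists tl, tr; split=> //; split=> //.
- move=> k u v; apply: B_cancel => b.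
  by rewrite -Htr !(bm_mull HB) !Htr.
- by move=> x y; apply: B_cancel => b; rewrite -Htr -!(mB_assoc HF) Htr.
Qed.

(** For left multiplication by [B], [phi ((tl x) a) = mu_B ((tl x) Bphi(a)) =
    mu_B (sigma(Bphi a) (tl x)) = mu_B (tr(sigma(Bphi a)) x)]: the modular
    automorphism brings [Bphi a] to the side on which the multiplier can be moved
    from [x] to it.  In the other cases [tA] commutes with the action. *)
Lemma mult_left_integral tl tr (tA : A -> A) :
  double_multiplier (@mB K F) tl tr -> linear tA ->
  (forall x a, tA (lB x a) = lB (tl x) a) ->
  frame_integral (fun a => phi (tA a)).
Proof.
move=> Ht tAL tAB.
have tA_comm (f : A -> A) : linear f ->
    (forall x a, f (lB x a) = lB x (f a)) -> forall a, tA (f a) = f (tA a).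
  move=> fL fB; apply: (spans_ext (bm_lspan HB)
    (lin_comp tAL fL) (lin_comp fL tAL)) => x a.
  by rewrite fB !tAB fB.
have tA_rB x := tA_comm _ (bm_rr HB x) (fun x' a => esym (lB_rB HF x' x a)).
have tA_lC y := tA_comm _ (bm_lr (frameC HF) y)
  (fun x a => esym (lBC HF x y a)).
have tA_rC y := tA_comm _ (bm_rr (frameC HF) y)
  (fun x a => esym (lB_rC HF x y a)).
exists (fun a => sBi (sCi (tr (sigma (Bphi a))))), (fun a => phiB (tA a)),
  (fun a => Cphi (tA a)), (fun a => phiC (tA a)); split.
  split=> [k u v|x a|x a|y a|y a].
  - by rewrite tAL (fad_lin phi_ad).
  - rewrite tAB (fad_Bl phi_ad) full_modular (dm_mid Ht) [RHS]full_modular.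
    by rewrite {2}/sigma (anti_invK (frame_sB HF)) (anti_invK (frame_sC HF)).
  - by rewrite tA_rB (fad_Br phi_ad).
  - by rewrite tA_lC (fad_Cl phi_ad).
  - by rewrite tA_rC (fad_Cr phi_ad).
move=> a b; rewrite -(fp_phi_inv Hfp).
have balt : balanced (fun p q => pure (hX P) p (tA q)).
  exact: (balanced_pure HX (f := id)).
have -> : cDl (hX P) (tA b) a =
    bext (hX P) (fun p q => pure (hX P) p (tA q)) (cDl (hX P) b a).
  move: b; apply: (spans_ext (bm_lspan HB)
    (lin_comp (cDl_linl HF HX a) tAL)
    (lin_comp (bext_linear HX balt) (cDl_linl HF HX a))) => x b /=.
  rewrite tAB !(cDl_lB HF HX) (bext_bext HX id _ _ balt).
  by apply: eq_bext => p q; rewrite tAB.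
by rewrite (bext_bext HX id _ _ (bal_slice HP phi_ad)).
Qed.

End Uniqueness.

(** * Concrete tensor products and multipliers *)

Section TensorFacts.
Variables (K : fieldType) (U V : lmodType K) (I : Type).
Variables (f : I -> U -> U) (g : I -> V -> V).

Lemma tens_piE (s : {malg K[(U * V)%type]}) : tens_pi f g s =
  \sum_(p <- msupp s) s@_p *: tpure p.1 p.2 :> tens f g.
Proof.
have piD := @tens_piD K U V I f g.
have piS (T : Type) (r : seq T) F :
    tens_pi f g (\sum_(i <- r) F i) = \sum_(i <- r) tens_pi f g (F i).
  elim: r => [|i r IH]; last by rewrite !big_cons piD IH.
  rewrite !big_nil; apply: (addIr (tens_pi f g 0)).
  by rewrite -piD !add0r.
rewrite {1}[s]monalgE piS; apply: eq_bigr => -[u v] _ /=.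
rewrite -[_ *: _]/(tens_scale _ _) -tens_piZ; congr tens_pi.
by apply/malgP => k; rewrite mcoeffZ !mcoeffU mulrnAr mulr1.
Qed.

Lemma tlift_id (t : tens f g) : tlift (fun u v => tpure u v : tens f g) t = t.
Proof. by rewrite -{2}[t]tens_reprK tens_piE. Qed.

Lemma tlift_sum (t : tens f g) : exists s : seq (K * (U * V)),
  forall (W : lmodType K) (F : U -> V -> W),
    tlift F t = \sum_(p <- s) p.1 *: F p.2.1 p.2.2.
Proof.
exists [seq ((tens_repr t)@_p, p) | p <- msupp (tens_repr t)] => W F.
by rewrite big_map.
Qed.

Lemma tlift_lin (W W' : lmodType K) (L : W -> W') (F : U -> V -> W)
    (t : tens f g) :
  linear L -> L (tlift F t) = tlift (fun u v => L (F u v)) t.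
Proof.
move=> LL; have [s Hs] := tlift_sum t.
by rewrite !Hs (lin_sum LL); apply: eq_bigr => p _; rewrite (lin_scale LL).
Qed.

End TensorFacts.

Section MultiplierFacts.
Variables (K : fieldType) (A : nualgType K).
Implicit Types (T : multiplier A).
Local Open Scope nualg_scope.

Lemma multiplierP T : is_multiplier (mulval T).
Proof. exact/asboolP/mulvalP. Qed.

Lemma lact_linr T : linear (lact T).
Proof. by have [[]] := multiplierP T. Qed.
Lemma ract_linl T : linear (fun a => ract a T).
Proof. by have [[]] := multiplierP T. Qed.
Lemma lactM S T (a : A) : (S ** T) ▷ a = S ▷ (T ▷ a). Proof. by []. Qed.
Lemma ractM S T (a : A) : a ◁ (S ** T) = a ◁ S ◁ T. Proof. by []. Qed.
Lemma lact_mul T (a b : A) : T ▷ (a ** b) = (T ▷ a) ** b.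
Proof. by have [_ [Tl _ _]] := multiplierP T; apply: Tl. Qed.
Lemma ract_mul T (a b : A) : (a ** b) ◁ T = a ** (b ◁ T).
Proof. by have [_ [_ Tr _]] := multiplierP T; apply: Tr. Qed.
Lemma lact_ract T (a b : A) : (a ◁ T) ** b = a ** (T ▷ b).
Proof. by have [_ [_ _ Tm]] := multiplierP T; apply/esym/Tm. Qed.

Hypothesis A_nd : Defs.nondegenerate A.

Lemma nondegl (a : A) : (forall b, a ** b = 0) -> a = 0.
Proof.
move=> a0; apply: contrapT => /eqP/A_nd[[b /eqP]]; by rewrite a0.
Qed.

Lemma nondegr (a : A) : (forall b, b ** a = 0) -> a = 0.
Proof.
move=> a0; apply: contrapT => /eqP/A_nd[_ [b /eqP]]; by rewrite a0.
Qed.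

Lemma multiplier_lext T : (forall a, T ▷ a = 0) -> T = 0.
Proof.
move=> T0; apply/val_inj/injective_projections; apply: funext => a.
  exact: T0.
apply: nondegl => b; have := lact_ract T a b.
by rewrite T0 numul0r.
Qed.

Lemma multiplier_rext T : (forall a, a ◁ T = 0) -> T = 0.
Proof.
move=> T0; apply/val_inj/injective_projections; apply: funext => a.
  apply: nondegr => b; have := lact_ract T b a.
  by rewrite T0 numul0l.
exact: T0.
Qed.

Lemma subalg_bimultiplier (B : subalgM A) :
  spans (lact_sub B) -> spans (ract_sub B) ->
  @bimultiplier K A (B : nualgType K) (@numul K A) (@numul K B)
    (fun x a => lact (subalgM_val x) a) (fun x a => ract a (subalgM_val x)).
Proof.
move=> sl sr; split=> //.
- exact: numul_linearl.
- exact: numul_linearr.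
- by move=> x; apply: lact_linr.
- by move=> x; apply: ract_linl.
- by move=> x a b; apply: lact_mul.
- by move=> x a b; apply: ract_mul.
- by move=> x a b; apply: lact_ract.
- move=> a; have [s ->] := sr a; exists (map (fun p => (p.2, p.1)) s).
  by rewrite big_map.
- by move=> x x0; apply: val_inj; apply: multiplier_lext.
- by move=> x x0; apply: val_inj; apply: multiplier_rext.
Qed.

(** A multiplier [T'] of [B] acts on [A = B A = A B] by [T (x a) = (T' x) a]; this is
    well defined because [y (T' x) a = (y T') (x a)] for [y] in [B]. *)
Lemma extend_multiplier (B : subalgM A) (T' : multiplier (B : nualgType K)) :
  spans (lact_sub B) -> spans (ract_sub B) ->
  exists T : multiplier A,
    (forall (x : B) (a : A), T ▷ (x ▷ a) = (T' ▷ x) ▷ a) /\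
    (forall (x : B) (a : A), (a ◁ x) ◁ T = a ◁ (x ◁ T')).
Proof.
move=> sl sr.
have HB := subalg_bimultiplier sl sr.
have T'mid (x y : B) : x ** (T' ▷ y) = (x ◁ T') ** y.
  by have /asboolP[_ [_ _ ->]] := mulvalP T'.
have lB0 (a : A) : (forall y : B, y ▷ a = 0) -> a = 0.
  move=> a0; apply: nondegr => b.
  apply: (spans_vanish sr (f := fun b => b ** a)); first exact: numul_linearl.
  by move=> c y; rewrite /ract_sub lact_ract a0 numul0r.
have rB0 (a : A) : (forall y : B, a ◁ y = 0) -> a = 0.
  move=> a0; apply: nondegl => b.
  apply: (spans_vanish sl (f := fun b => a ** b)); first exact: numul_linearr.
  by move=> y c; rewrite /lact_sub -lact_ract a0 numul0l.
have ylsum (y : B) s : y ▷ (\sum_(p <- s) (T' ▷ p.1) ▷ p.2) =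
    (y ◁ T') ▷ (\sum_(p <- s) (p.1 : multiplier A) ▷ p.2).
  rewrite !(lin_sum (lact_linr _)); apply: eq_bigr => p _.
  by rewrite -!(bm_lM HB) T'mid.
have yrsum (y : B) s : (\sum_(p <- s) p.1 ◁ (p.2 ◁ T' : B)) ◁ y =
    (\sum_(p <- s) p.1 ◁ (p.2 : B)) ◁ (T' ▷ y : B).
  rewrite !(lin_sum (ract_linl _)); apply: eq_bigr => p _.
  by rewrite -!(bm_rM HB) T'mid.
have /choice [T1 HT1] (a : A) : exists b : A,
    forall y : B, y ▷ b = (y ◁ T') ▷ a.
  have [s ->] := sl a.
  by exists (\sum_(p <- s) (T' ▷ p.1) ▷ p.2) => y; rewrite ylsum.
have /choice [T2 HT2] (a : A) : exists b : A,
    forall y : B, b ◁ y = a ◁ (T' ▷ y).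
  have [s ->] := sr a.
  by exists (\sum_(p <- s) p.1 ◁ (p.2 ◁ T' : B)) => y; rewrite yrsum.
have lB_inj (a b : A) : (forall y : B, y ▷ a = y ▷ b) -> a = b.
  move=> ab; apply/eqP; rewrite -subr_eq0; apply/eqP/lB0 => y.
  by rewrite (lin_sub (lact_linr _)) ab subrr.
have rB_inj (a b : A) : (forall y : B, a ◁ y = b ◁ y) -> a = b.
  move=> ab; apply/eqP; rewrite -subr_eq0; apply/eqP/rB0 => y.
  by rewrite (lin_sub (ract_linl _)) ab subrr.
have Tmult : is_multiplier (T1, T2).
  split=> /=; split.
  - by move=> k u v; apply: lB_inj => y; rewrite HT1 !lact_linr !HT1.
  - by move=> k u v; apply: rB_inj => y; rewrite HT2 !ract_linl !HT2.
  - by move=> a b; apply: lB_inj => y; rewrite HT1 !lact_mul HT1.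
  - by move=> a b; apply: rB_inj => y; rewrite HT2 !ract_mul HT2.
  move=> a b.
  apply: (spans_ext sr (f := fun a => a ** T1 b) (g := fun a => T2 a ** b)).
  - exact: numul_linearl.
  - move=> k u v; rewrite -numulZl -numulDl; congr (_ ** b).
    by apply: rB_inj => y; rewrite HT2 !ract_linl !HT2.
  move=> c y; rewrite /ract_sub lact_ract HT1 -lact_ract; congr (_ ** b).
  by apply: rB_inj => z; rewrite HT2 -!(bm_rM HB) T'mid.
exists (Multiplier (introT (asboolP _) Tmult)); split=> x a.
  by apply: lB_inj => y; rewrite [LHS]HT1 -!(bm_lM HB) T'mid.
by apply: rB_inj => y; rewrite [LHS]HT2 -!(bm_rM HB) T'mid.
Qed.

End MultiplierFacts.

(** * The Hopf data of a multiplier Hopf algebroid *)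

Lemma frame_shuffle (K : fieldType) (F : frame K) : frame_axioms F ->
  forall x x' y y' (a : fA F),
  lB x (rC y' (rB x' (lC y a))) = lB x (lC y (rB x' (rC y' a))).
Proof. by move=> HF x x' y y' a; rewrite -(lC_rB HF) -(lC_rC HF) (rBC HF). Qed.

Lemma frame_shuffle_op (K : fieldType) (F : frame K) : frame_axioms F ->
  forall x x' y y' (a : fA F),
  lB x (rC y' (rB x' (lC y a))) = rB x' (rC y' (lB x (lC y a))).
Proof. by move=> HF x x' y y' a; rewrite (lB_rC HF) (lB_rB HF) (rBC HF). Qed.

Section Graph.
Variables (K : fieldType) (G : qgraph K).
Local Open Scope nualg_scope.

Definition graph_frame : frame K :=
  @Frame K (qA G) (qB G : nualgType K) (qC G : nualgType K)
    (@numul K (qA G)) (@numul K (qB G)) (@numul K (qC G))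
    (fun x a => (x : multiplier G) ▷ a) (fun x a => a ◁ (x : multiplier G))
    (fun y a => (y : multiplier G) ▷ a) (fun y a => a ◁ (y : multiplier G))
    (SB G) (antiiso_inv (SB G)) (SC G) (antiiso_inv (SC G)).

Lemma antiiso_axioms (D E : nualgType K) (s : antiiso D E) :
  antiisomorphic (@numul K D) (@numul K E) s (antiiso_inv s).
Proof.
have sK := antiiso_funK s; have siK := antiiso_invK s.
split=> //.
- by move=> k u v; rewrite linearP.
- by move=> k u v; apply: (can_inj sK); rewrite linearP !siK.
- exact: antiiso_mul.
- by move=> x y; apply: (can_inj sK); rewrite antiiso_mul !siK.
Qed.

Lemma graph_frame_axioms : frame_axioms graph_frame.
Proof.
have nd := @qA_nondegenerate K G.
split=> /=.
- exact: numul_linearl.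
- exact: numul_linearr.
- exact: numulA.
- exact: nondegl.
- exact: nondegr.
- exact: (subalg_bimultiplier nd (@qBA K G) (@qAB K G)).
- exact: (subalg_bimultiplier nd (@qCA K G) (@qAC K G)).
- by move=> x y a; rewrite -!lactM qBC_commute.
- by move=> x y a; rewrite -!ractM qBC_commute.
- exact: antiiso_axioms.
- exact: antiiso_axioms.
Qed.

Lemma tlift_span (U V W : lmodType K) (I : Type) (f : I -> U -> U)
    (g : I -> V -> V) (F : U -> V -> W) :
  bijective (fun t : tens f g => tlift F t) ->
  forall w, exists s : seq (K * (U * V)),
    w = \sum_(p <- s) p.1 *: F p.2.1 p.2.2.
Proof.
by case=> h _ hK w; have [s Hs] := tlift_sum (h w);
  exists s; rewrite -Hs hK.
Qed.

Section LeftComul.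
Variable d : left_comult G.
Hypothesis Tl_bij :
  bijective (fun t : tens_upC G => tlift (fun a b => DBl d b a) t).
Hypothesis Tr_bij :
  bijective (fun t : tensB G => tlift (fun a b => DBr d a b) t).

Definition left_comul : comul (qA G) :=
  @Comul K (qA G) (tensl G) (fun a b => a ⊗ b)
    (fun V F t => tlift F t) (DB d) (DBl d) (DBr d).

Lemma left_comul_axioms : @comul_axioms K graph_frame left_comul.
Proof.
split=> /=.
- split.
  + exact: tpure_linearl.
  + exact: tpure_linearr.
  + by move=> x a b; exact: (tpure_bal (@fl K G) (@gl K G)).
- exact: tlift_sum.
- exact: tlift_id.
- by move=> V F [Fl Fr Fm] a b; apply: tlift_pure.
- by move=> V F [Fl Fr Fm]; apply: tlift_linear.
- exact: DB_end.
- exact: DB_linear.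
- exact: DB_mul.
- exact: DB_r.
- exact: DB_l.
- exact: DBr_unique.
- exact: DBl_unique.
- move=> x x' y y' a t.
  rewrite -(DB_bimod d x x' y y' a t); congr (DB d _ t).
  exact/esym/(frame_shuffle graph_frame_axioms).
- exact: tlift_span Tl_bij.
- exact: tlift_span Tr_bij.
Qed.

End LeftComul.

Section RightComul.
Variable d : right_comult G.
Hypothesis lT_bij :
  bijective (fun t : tensC G => tlift (fun a b => DCl d b a) t).
Hypothesis rT_bij :
  bijective (fun t : tens_upB G => tlift (fun a b => DCr d a b) t).

Definition right_comul : comul (qA G) :=
  @Comul K (qA G) (tensr G) (fun a b => a ⊗ b)
    (fun V F t => tlift F t) (DC d) (DCl d) (DCr d).

Lemma right_comul_axioms : @comul_axioms K (fop graph_frame) right_comul.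
Proof.
have bal (V : lmodType K) (F : G -> G -> V) :
    @balanced K (fop graph_frame) V F ->
    forall y a b, F (fr y a) b = F a (gr y b).
  case=> _ _ Fm y a b; have /= := Fm (SC G y) a b.
  by rewrite antiiso_funK.
split=> /=.
- split.
  + exact: tpure_linearl.
  + exact: tpure_linearr.
  + move=> x a b; rewrite /= -{1}[x](antiiso_invK (SC G)).
    exact: (tpure_bal (@fr K G) (@gr K G)).
- exact: tlift_sum.
- exact: tlift_id.
- by move=> V F HF a b; apply: tlift_pure; [case: HF | case: HF | apply: bal].
- by move=> V F HF; apply: tlift_linear; [case: HF | case: HF | apply: bal].
- exact: DC_end.
- exact: DC_linear.
- by move=> a b t; apply: DC_mul.
- by move=> a b c; apply: DC_r.
- by move=> a b c; apply: DC_l.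
- by move=> a c t; apply: DCr_unique.
- by move=> a b t; apply: DCl_unique.
- move=> x x' y y' a t.
  rewrite -(DC_bimod d x' x y' y a t); congr (DC d _ t).
  exact/esym/(frame_shuffle_op graph_frame_axioms).
- exact: tlift_span lT_bij.
- exact: tlift_span rT_bij.
Qed.

End RightComul.
End Graph.

Section TripleTensors.
Variables (K : fieldType) (A V : lmodType K) (I J : Type).
Variables (f g : I -> A -> A) (f' g' : J -> A -> A).
Variable T : A -> A -> A -> V.
Hypothesis T1 : forall b c, linear (fun a => T a b c).
Hypothesis T2 : forall a c, linear (fun b => T a b c).
Hypothesis T3 : forall a b, linear (T a b).
Hypothesis T12 : forall i a b c, T (f i a) b c = T a (g i b) c.
Hypothesis T23 : forall j a b c, T a (f' j b) c = T a b (g' j c).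
Local Open Scope nualg_scope.

(** The map on the triple tensor product induced by a balanced trilinear map. *)
Definition tlift3 (t : tens3 f g f' g') : V :=
  tlift (fun (t : tens f g) c => tlift (fun a b => T a b c) t) t.

Lemma tlift_linear_param (t : tens f g) :
  linear (fun c => tlift (fun a b => T a b c) t).
Proof.
have [s Hs] := tlift_sum t => k u v; rewrite !Hs scaler_sumr -big_split.
apply: eq_bigr => p _ /=; rewrite T3 scalerDr !scalerA.
by rewrite [p.1 * k]mulrC.
Qed.

Let T3_bal j (t : tens f g) c :
  tlift (fun a b => T a b c)
    (tlift (fun a b => (a ⊗ f' j b : tens f g)) t) =
  tlift (fun a b => T a b (g' j c)) t.
Proof.
have L : linear (fun t : tens f g => tlift (fun a b => T a b c) t).
  by apply: tlift_linear => // *; rewrite ?T1 ?T2 ?T12.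
rewrite (tlift_lin _ _ L); congr tlift.
apply: funext => a; apply: funext => b.
by rewrite tlift_pure // => *; rewrite ?T1 ?T2 ?T12.
Qed.

Lemma tlift3_linear : linear tlift3.
Proof.
apply: tlift_linear => [c|t|j t c]; last exact: T3_bal.
  by apply: tlift_linear => // *; rewrite ?T1 ?T2 ?T12.
exact: tlift_linear_param.
Qed.

Lemma tlift3_pure (t : tens f g) c :
  tlift3 (t ⊗ c) = tlift (fun a b => T a b c) t.
Proof.
apply: tlift_pure => [{}c|{}t|j {}t {}c]; last exact: T3_bal.
  by apply: tlift_linear => // *; rewrite ?T1 ?T2 ?T12.
exact: tlift_linear_param.
Qed.

Lemma tlift3_cons a (t : tens f' g') :
  tlift3 (tcons a t) = tlift (fun b c => T a b c) t.
Proof.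
rewrite /tcons (tlift_lin _ _ tlift3_linear); congr tlift.
apply: funext => b; apply: funext => c; rewrite tlift3_pure.
by rewrite tlift_pure // => *; rewrite ?T1 ?T2 ?T12.
Qed.

Lemma tens3_coassoc (Dl : A -> A -> tens f g) (Dr : A -> A -> tens f' g')
    (t : tens f' g') (t' : tens f g) a c :
  tlift (fun p q => (Dl p a ⊗ q : tens3 f g f' g')) t =
    tlift (fun p q => (tcons p (Dr q c) : tens3 f g f' g')) t' ->
  tlift (fun p q => tlift (fun u v => T u v q) (Dl p a)) t =
    tlift (fun u v => tlift (fun p q => T u p q) (Dr v c)) t'.
Proof.
move=> /(congr1 tlift3) E.
transitivity (tlift3 (tlift (fun p q => (Dl p a ⊗ q : tens3 f g f' g')) t)).
  rewrite (tlift_lin _ _ tlift3_linear); congr tlift.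
  by apply: funext => p; apply: funext => q; rewrite tlift3_pure.
rewrite E (tlift_lin _ _ tlift3_linear); congr tlift.
by apply: funext => p; apply: funext => q; rewrite tlift3_cons.
Qed.

End TripleTensors.

Lemma scalar_ext (K : fieldType) (V : lmodType K) (f g : {scalar V}) :
  f =1 g -> f = g.
Proof.
case: f g => f [[fD] [fZ]] [g [[gD] [gZ]]] /= fg.
have {}fg : f = g by apply: funext.
case: _ / fg in gD gZ *.
by rewrite (Prop_irrelevance fD gD) (Prop_irrelevance fZ gZ).
Qed.

Section Instance.
Variables (K : fieldType) (H : regular_mult_hopf_algebroid K).
Variables (eB : {linear H -> qB H}) (eC : {linear H -> qC H}).
Variables (wtB : {scalar qB H}) (wtC : {scalar qC H}).
Hypotheses (eB_counit : is_left_counit eB) (eC_counit : is_right_counit eC).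
Hypothesis mu_weight : is_base_weight eB eC wtB wtC.
Local Open Scope nualg_scope.

Let L := left_comul (bleft H).
Let R := right_comul (bright H).
Let HF := graph_frame_axioms H.

Definition hopf_of_algebroid : hopf K :=
  @Hopf K (graph_frame H) L R (fun a => eB a) (fun a => SC H (eC a))
    (fun x => wtB x) (fun y => wtC y).

Lemma hopf_rl : @mixed_coassoc K (graph_frame H) L R.
Proof.
move=> V T bal1 bal2 a b c; apply: tens3_coassoc (b_compat_rl a b c) => /=.
- by move=> v w; apply: bal_l (bal1 w) v.
- by move=> u w; apply: bal_r (bal1 w) u.
- by move=> u v; apply: bal_r (bal2 u) v.
- move=> y u v w; have := bal_m (bal1 w) (SC H y) u v.
  by rewrite /= antiiso_funK.
- by move=> x u v w; apply: bal_m (bal2 u) x v w.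
Qed.

Lemma hopf_lr : @mixed_coassoc K (fop (graph_frame H)) R L.
Proof.
move=> V T bal1 bal2 a b c; apply: tens3_coassoc (b_compat_lr a b c) => /=.
- by move=> v w; apply: bal_l (bal1 w) v.
- by move=> u w; apply: bal_r (bal1 w) u.
- by move=> u v; apply: bal_r (bal2 u) v.
- by move=> x u v w; apply: bal_m (bal1 w) x u v.
- move=> y u v w; have := bal_m (bal2 u) (SC H y) v w.
  by rewrite /= antiiso_funK.
Qed.

Lemma hopf_of_algebroid_axioms : hopf_axioms hopf_of_algebroid.
Proof.
have [Tl_bij Tr_bij lT_bij rT_bij] := hopf_regular H.
have [eB1 eB2 eB3 eB4 eB5 eB6] := eB_counit.
have [eC1 eC2 eC3 eC4 eC5 eC6] := eC_counit.
have [wB_f wC_f BsC CsB mue] := mu_weight.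
have nondeg (D : nualgType K) (m : {scalar D}) : faithful_functional m ->
    (forall z, (forall x, m (x ** z) = 0) -> z = 0) /\
    (forall z, (forall x, m (z ** x) = 0) -> z = 0).
  by move=> mf; split=> z z0; apply: contrapT => /eqP/mf[[x /eqP +] [y /eqP +]];
    rewrite !z0.
split.
- exact: HF.
- exact: (left_comul_axioms Tl_bij Tr_bij).
- exact: (right_comul_axioms lT_bij rT_bij).
- exact: hopf_rl.
- exact: hopf_lr.
- by split=> //; move=> k u v; apply: linearP.
- split=> /=.
  + by move=> k u v; rewrite !linearP.
  + move=> x a; rewrite -{1}[x](antiiso_invK (SC H)) eC2 antiiso_mul.
    by rewrite antiiso_invK.
  + by move=> x a; rewrite eC1 antiiso_mul antiiso_invK.
  + move=> a b; rewrite -eC3; congr tlift.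
    by do 2!apply: funext => ?; rewrite antiiso_funK.
  + by move=> a b; rewrite -eC4.
  + by move=> a b; rewrite eC6.
  + by move=> a b; rewrite eC5 antiiso_funK.
- by move=> k u v; apply: linearP.
- by move=> k u v; apply: linearP.
- exact: (nondeg _ _ wB_f).1.
- exact: (nondeg _ _ wB_f).2.
- exact: (nondeg _ _ wC_f).1.
- exact: (nondeg _ _ wC_f).2.
- exact: CsB.
- exact: BsC.
- by move=> a; rewrite /= BsC.
Qed.

Lemma adapted_to_frame (w : {scalar H}) Bw wB Cw wC :
  adapted_by wtB wtC w Bw wB Cw wC ->
  @frame_adapted K hopf_of_algebroid (fun a => w a) Bw wB Cw wC.
Proof. by case=> *; split=> //; apply: linearP. Qed.

Lemma adapted_of_frame (w : {scalar H}) Bw wB Cw wC :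
  @frame_adapted K hopf_of_algebroid (fun a => w a) Bw wB Cw wC ->
  adapted_by wtB wtC w Bw wB Cw wC.
Proof. by case. Qed.

Lemma left_integralE (w : {scalar H}) :
  left_integral wtB wtC w <->
  frame_integral (P := hopf_of_algebroid) (fun a => w a).
Proof.
split=> -[Bw [wB [Cw [wC [w_ad w_inv]]]]]; exists Bw, wB, Cw, wC.
  by split; [apply: adapted_to_frame | ].
by split; [apply: adapted_of_frame | ].
Qed.

Lemma right_integralE (w : {scalar H}) :
  right_integral wtB wtC w <->
  frame_integral (P := hco hopf_of_algebroid) (fun a => w a).
Proof.
split=> -[Bw [wB [Cw [wC [w_ad w_inv]]]]]; exists Cw, wC, Bw, wB.
  split; last by move=> a b; apply: w_inv.
  exact/adapted_co/adapted_to_frame.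
split; last by move=> a b; apply: w_inv.
by apply: adapted_of_frame; case: w_ad => *; split.
Qed.

Variables (phi psi : {scalar H}).
Hypotheses (phi_full : full_left_integral wtB wtC phi)
  (phi_faithful : faithful_functional phi)
  (psi_full : full_right_integral wtB wtC psi)
  (psi_faithful : faithful_functional psi).

(** The base-valued versions are unique as the base weight is faithful, so the
    surjective ones are those for which invariance is known. *)
Lemma full_pair_integrals : exists Bphi phiB Cphi phiC Bpsi psiB Cpsi psiC,
  @full_pair K hopf_of_algebroid (fun a => phi a) Bphi phiB Cphi phiC
    (fun a => psi a) Bpsi psiB Cpsi psiC.
Proof.
have HP := hopf_of_algebroid_axioms.
case: phi_full => -[Bphi0 [phiB0 [Cphi0 [phiC0 [/adapted_to_frame ad0 inv0]]]]].
case=> Bphi [phiB [Cphi [phiC [/adapted_to_frame ad [Bphi_s phiB_s]]]]].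
case: psi_full.
case=> Bpsi0 [psiB0 [Cpsi0 [psiC0 [/adapted_to_frame pad0 pinv0]]]].
case=> Bpsi [psiB [Cpsi [psiC [/adapted_to_frame pad [Cpsi_s psiC_s]]]]].
have nondeg (m : {scalar H}) : faithful_functional m ->
    @nondeg_functional K (graph_frame H) (fun a => m a).
  by move=> mf; split=> z z0; apply: contrapT => /eqP/mf[[x /eqP +] [y /eqP +]];
    rewrite !z0.
have EC : Cphi0 = Cphi.
  apply: funext => a; apply: (muC_eql HP) => y.
  by rewrite -(fad_Cl ad) -(fad_Cl ad0).
have EB : Bpsi0 = Bpsi.
  apply: funext => a; apply: (muB_eql HP) => x.
  by rewrite -(fad_Bl pad) -(fad_Bl pad0).
exists Bphi, phiB, Cphi, phiC, Bpsi, psiB, Cpsi, psiC; split=> //.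
- by rewrite -EC; apply: inv0.
- exact: nondeg.
- by rewrite -EB => a b; apply: pinv0.
- exact: nondeg.
Qed.

End Instance.

Section Translates.
Variables (K : fieldType) (A : nualgType K) (D : subalgM A).
Hypotheses (A_nd : Defs.nondegenerate A) (sl : spans (lact_sub D))
  (sr : spans (ract_sub D)).
Variables (phi : {scalar A}) (I : set {scalar A}).
Local Open Scope nualg_scope.
Local Open Scope classical_set_scope.

Lemma multiplier_bimult (T' : multiplier (D : nualgType K)) :
  double_multiplier (@numul K D) (fun x => T' ▷ x) (fun x => x ◁ T').
Proof.
split; [exact: lact_linr | exact: ract_linl | exact: lact_mul |
  exact: ract_mul | by move=> x y; rewrite lact_ract].
Qed.

Lemma bimult_multiplier (tl tr : D -> D) :
  double_multiplier (@numul K D) tl tr ->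
  exists T' : multiplier (D : nualgType K),
    (forall x, T' ▷ x = tl x) /\ (forall x, x ◁ T' = tr x).
Proof.
case=> lL rL lA rA mid.
have T'P : is_multiplier (tl, tr) by split.
by exists (Multiplier (introT (asboolP _) T'P)).
Qed.

Lemma integrals_ract :
  (forall w : {scalar A}, I w ->
    exists tl tr, double_multiplier (@numul K D) tl tr /\
      forall (b : D) x, w (b ▷ x) = phi (tl b ▷ x)) ->
  (forall (T : multiplier A) (tl tr : D -> D),
    double_multiplier (@numul K D) tl tr ->
    (forall (x : D) a, T ▷ (x ▷ a) = tl x ▷ a) -> I (dual_ract T phi)) ->
  I = [set dual_ract T phi | T in mult_of_subalg D].
Proof.
move=> I_mult mult_I; apply/seteqP; split=> [w /I_mult|w [T [T' [Tl Tr]] <-]].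
  case=> tl [tr [/bimult_multiplier[T' [T'l T'r]] wE]].
  have [T [Tl Tr]] := extend_multiplier A_nd T' sl sr.
  exists T; first by exists T'.
  apply: scalar_ext; apply: (spans_ext (V := K^o) sl).
  - by move=> k u v; apply: linearP.
  - by move=> k u v; apply: linearP.
  by move=> x a; rewrite /= /dual_ract_fun /lact_sub Tl T'l wE.
exact: mult_I (multiplier_bimult T') Tl.
Qed.

Lemma integrals_lact :
  (forall w : {scalar A}, I w ->
    exists tl tr, double_multiplier (@numul K D) tl tr /\
      forall (b : D) x, w (x ◁ b) = phi (x ◁ tr b)) ->
  (forall (T : multiplier A) (tl tr : D -> D),
    double_multiplier (@numul K D) tl tr ->
    (forall (x : D) a, (a ◁ x) ◁ T = a ◁ tr x) -> I (dual_lact T phi)) ->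
  [set dual_lact T phi | T in mult_of_subalg D] = I.
Proof.
move=> I_mult mult_I; apply/seteqP; split=> [w [T [T' [Tl Tr]] <-]|w /I_mult].
  exact: mult_I (multiplier_bimult T') Tr.
case=> tl [tr [/bimult_multiplier[T' [T'l T'r]] wE]].
have [T [Tl Tr]] := extend_multiplier A_nd T' sl sr.
exists T; first by exists T'.
apply: scalar_ext; apply: (spans_ext (V := K^o) sr).
- by move=> k u v; apply: linearP.
- by move=> k u v; apply: linearP.
by move=> a x; rewrite /= /dual_lact_fun /ract_sub Tr T'r wE.
Qed.

End Translates.

Local Open Scope complex_scope.
Local Open Scope classical_set_scope.

Theorem theorem3p3p8 (R : realType)
  (H : regular_mult_hopf_algebroid R[i]) (H_flat : is_flat H)
  (eB : {linear H -> qB H}) (eB_counit : is_left_counit eB)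
  (eC : {linear H -> qC H}) (eC_counit : is_right_counit eC)
  (muB : {scalar qB H}) (muC : {scalar qC H})
  (mu_weight : is_base_weight eB eC muB muC)
  (phi : {scalar H}) (phi_full : full_left_integral muB muC phi)
  (phi_faithful : faithful_functional phi)
  (psi : {scalar H}) (psi_full : full_right_integral muB muC psi)
  (psi_faithful : faithful_functional psi) :
  ([set dual_lact T phi | T in mult_of_subalg (qB H)]
     = [set omega | left_integral muB muC omega] /\
   [set omega | left_integral muB muC omega]
     = [set dual_ract T phi | T in mult_of_subalg (qB H)]) /\
  ([set dual_lact T psi | T in mult_of_subalg (qC H)]
     = [set omega | right_integral muB muC omega] /\
   [set omega | right_integral muB muC omega]
     = [set dual_ract T psi | T in mult_of_subalg (qC H)]).
Proof.
have HP := hopf_of_algebroid_axioms eB_counit eC_counit mu_weight.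
have [Bphi [phiB [Cphi [phiC [Bpsi [psiB [Cpsi [psiC Hfp]]]]]]]] :=
  full_pair_integrals eB_counit eC_counit mu_weight
    phi_full phi_faithful psi_full psi_faithful.
set P := hopf_of_algebroid _ _ _ _ in HP Hfp.
have nd := @qA_nondegenerate _ H.
have HPo := hop_axioms HP; have Hfpo := full_pair_op HP Hfp.
have HPc := hco_axioms HP; have Hfpc := full_pair_co Hfp.
have HPco := hop_axioms HPc; have Hfpco := full_pair_op HPc Hfpc.
have leftE := left_integralE eB eC muB muC.
have rightE := right_integralE eB eC muB muC.
split; split.
- apply: (integrals_lact nd (@qBA _ H) (@qAB _ H)) => [w|T tl tr Ht HT].
    move=> /leftE/(frame_integral_op HP Hfp)/(left_integral_mult HPo Hfpo).
    case=> tl [tr [/double_multiplier_op Ht wE]]; exists tr, tl.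
    by split.
  apply/leftE/(frame_integral_op HPo Hfpo).
  exact: (mult_left_integral HPo Hfpo (double_multiplier_op Ht) (ract_linl T)).
- apply: (integrals_ract nd (@qBA _ H) (@qAB _ H)) => [w|T tl tr Ht HT].
    by move=> /leftE/(left_integral_mult HP Hfp).
  apply/leftE.
  exact: (mult_left_integral HP Hfp Ht (lact_linr T)).
- apply: (integrals_lact nd (@qCA _ H) (@qAC _ H)) => [w|T tl tr Ht HT].
    move=> /rightE/(frame_integral_op HPc Hfpc)/(left_integral_mult HPco Hfpco).
    case=> tl [tr [/double_multiplier_op Ht wE]]; exists tr, tl.
    by split.
  apply/rightE/(frame_integral_op HPco Hfpco).
  exact: (mult_left_integral HPco Hfpco (double_multiplier_op Ht)
    (ract_linl T)).
- apply: (integrals_ract nd (@qCA _ H) (@qAC _ H)) => [w|T tl tr Ht HT].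
    by move=> /rightE/(left_integral_mult HPc Hfpc).
  apply/rightE.
  exact: (mult_left_integral HPc Hfpc Ht (lact_linr T)).
Qed.
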